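(* Let $(p,q)$ be either of the two pairs $(1,0)$, $(1,-1)$, let $\epsilon>0$ and $s>0$, and use the matrices and functions defined in the context. **One-dimensional case.** Let $\alpha\in(1,2)$ and $$\gamma=\gamma(h_t,h_x)=-\frac{h_t}{2h_x^{\alpha}\cos(\alpha\pi/2)} .$$ (i) If $\lim_{h_t,h_x\to0^+}\gamma(h_t,h_x)=\gamma^*<\infty$, then the symmetric positive definite matrix-sequence $\{A_{\alpha,M}\}_M$ satisfies $$\{A_{\alpha,M}\}_M\sim_\lambda 1-\epsilon^2\gamma^* f_\alpha(x).$$ (ii) If $\gamma(h_t,h_x)$ is unbounded with limit $\gamma^*=\infty$, then the scaled matrix-sequence $\hat A_{\alpha,M}=\gamma^{-1}(h_t,h_x)A_{\alpha,M}$ satisfies $$\{\hat A_{\alpha,M}\}_M\sim_\lambda-\epsilon^2 f_\alpha(x).$$ **Two-dimensional case.** Let $\boldsymbol\alpha=(\alpha_1,\alpha_2)$ with $\alpha_1,\alpha_2\in(1,2)$, and for $j=1,2$ let $$\gamma_j=\gamma_j(h_t,h_{x_j})=-\frac{h_t}{2h_{x_j}^{\alpha_j}\cos(\alpha_j\pi/2)} .$$ (iii) If $\lim_{h_t,h_{x_j}\to0^+}\gamma_j(h_t,h_{x_j})=\gamma_j^*<\infty$ for $j=1,2$, then the symmetric positive definite matrix-sequence $\{A_{\boldsymbol\alpha,\mathbf m}\}_{\mathbf m}$ satisfies $$\{A_{\boldsymbol\alpha,\mathbf m}\}_{\mathbf m}\sim_\lambda1-\epsilon^2\big(\gamma_1^*f_{\alpha_1}(x_1)+\gamma_2^*f_{\alpha_2}(x_2)\big),$$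 where necessarily $\gamma_2^*=0$ if $\alpha_1>\alpha_2$, and $\gamma_1^*=0$ if $\alpha_2>\alpha_1$. (iv) If $\gamma=\max_j\gamma_j=\gamma_{\hat j}$ (with $\hat j=1$ or $\hat j=2$) is unbounded with limit $\gamma^*=\infty$, then the scaled matrix-sequence $\hat A_{\boldsymbol\alpha,\mathbf m}=\gamma^{-1}A_{\boldsymbol\alpha,\mathbf m}$ satisfies $$\{\hat A_{\boldsymbol\alpha,\mathbf m}\}_{\mathbf m}\sim_\lambda-\epsilon^2f_{\alpha_{\hat j}}(x_{\hat j}).$$
   Context: **Coefficients.** For $\alpha\in(1,2)$ let $g_0^{(\alpha)}=1$ and $g_k^{(\alpha)}=\left(1-\frac{\alpha+1}{k}\right)g_{k-1}^{(\alpha)}$ for $k\ge1$. The weights $\omega_k^{(\alpha)}$ are: - for $(p,q)=(1,0)$: $\omega_0^{(\alpha)}=\frac{\alpha}{2}g_0^{(\alpha)}$ and $\omega_k^{(\alpha)}=\frac{\alpha}{2}g_k^{(\alpha)}+\frac{2-\alpha}{2}g_{k-1}^{(\alpha)}$ for $k\ge1$; - for $(p,q)=(1,-1)$: $\omega_k^{(\alpha)}=\frac{\alpha+2}{4}g_k^{(\alpha)}$ for $k=0,1$ and $\omega_k^{(\alpha)}=\frac{\alpha+2}{4}g_k^{(\alpha)}+\frac{2-\alpha}{4}g_{k-2}^{(\alpha)}$ for $k\ge2$. **Matrices.** $\mathcal G_{\alpha,M}$ is the $M\times M$ Toeplitz matrix with $(i,j)$ entry $\omega_{i-j+1}^{(\alpha)}$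 if $i-j+1\ge0$ and $0$ otherwise, and $G_{\alpha,M}=\mathcal G_{\alpha,M}+\mathcal G_{\alpha,M}^T$. **Symbol.** $f_\alpha:[-\pi,\pi]\to\mathbb R$ is the generating function of $\{G_{\alpha,M}\}_M$: $$f_\alpha(x)=b_\alpha(x)+\overline{b_\alpha(x)}=2\sum_{k=0}^\infty\omega_k^{(\alpha)}\cos((k-1)x),\qquad b_\alpha(x)=\sum_{k=0}^\infty\omega_k^{(\alpha)}e^{\mathrm i(k-1)x}.$$ **One-dimensional setting.** On an interval $(a,b)$, $h_x=(b-a)/(M+1)$. The time step is $h_t=T/N$ with $T>0$ fixed. With $\overline c_\alpha=-\left(2h_x^\alpha\cos(\alpha\pi/2)\right)^{-1}$, $$A_{\alpha,M}=(1+sh_t)I_M-\epsilon^2h_t\overline c_\alpha G_{\alpha,M}.$$ **Two-dimensional setting.** $\mathbf m=(M_1,M_2)$, $h_{x_j}=(b_j-a_j)/(M_j+1)$ on $(a_1,b_1)\times(a_2,b_2)$, $h_t=T/N$, $\overline c_{\alpha_j}=-\left(2h_{x_j}^{\alpha_j}\cos(\alpha_j\pi/2)\right)^{-1}$, and $$A_{\boldsymbol\alpha,\mathbf m}=(1+sh_t)I_{M_1M_2}-\epsilon^2h_t\left(\overline c_{\alpha_1}G_{\alpha_1,M_1}\otimes I_{M_2}+I_{M_1}\otimes\overline c_{\alpha_2}G_{\alpha_2,M_2}\right).$$ **Limits.** The discretization is refined so that all step sizes tend to $0$: $N$ depends on $M$ (respectively on $\mathbf m$), $M\to\infty$ (respectively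 $M_1,M_2\to\infty$), and $h_t\to0$. Limits of $\gamma,\gamma_j$ are along this refinement. **Eigenvalue distribution.** Let $D\subset\mathbb R^d$ be measurable with Lebesgue measure $\mu_d(D)\in(0,\infty)$ and $f:D\to\mathbb C$ measurable. A matrix-sequence $\{A_n\}_n$, with $A_n$ of size $d_n\to\infty$ and eigenvalues $\mu_j(A_n)$, satisfies $\{A_n\}_n\sim_\lambda f$ (on $D$) if for every continuous compactly supported $F:\mathbb C\to\mathbb C$, $$\lim_{n\to\infty}\frac1{d_n}\sum_{j=1}^{d_n}F(\mu_j(A_n))=\frac1{\mu_d(D)}\int_DF(f(t))\,dt.$$ For a two-index sequence, $n\to\infty$ means $M_1,M_2\to\infty$. In the one-dimensional claims $D=[-\pi,\pi]$; in the two-dimensional claims $D=[-\pi,\pi]^2$, with variables $(x_1,x_2)$.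
   Formalization: Along sequences of grids, (iv) also assumes that the other γ_j is negligible against γ_ĵ, or that h_{x1}, h_{x2} are of the same order and α_1≠α_2 (false if α_1=α_2, h_{x1}=h_{x2}); there ''necessarily γ_j*=0'' in (iii) assumes steps of the same order. *)

(* Defs.v *)
From HB Require Import structures.
From mathcomp Require Import all_boot all_order all_algebra.
From mathcomp Require Import all_classical all_reals all_analysis.
From mathcomp Require Export complex.
From mathcomp Require Export mxtens.

Set Implicit Arguments.
Unset Strict Implicit.
Unset Printing Implicit Defensive.

Import Order.TTheory GRing.Theory Num.Theory.
Import numFieldNormedType.Exports.

Local Open Scope classical_set_scope.
Local Open Scope ring_scope.

(* [complex R] seen as a numClosedFieldType, from which MathComp-Analysis
   derives the usual topology (that of the modulus). *)
Definition cplx (R : realType) : numClosedFieldType := R[i].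

Definition rc (R : realType) (x : R) : cplx R := real_complex R x.

Definition eigenvalues (R : realType) (n : nat) (A : 'M[cplx R]_n) :
    seq (cplx R) :=
  sval (closed_field_poly_normal (char_poly A)).

Lemma eigenvaluesP (R : realType) (n : nat) (A : 'M[cplx R]_n) :
  char_poly A = \prod_(z <- eigenvalues A) ('X - z%:P).
Proof.
rewrite /eigenvalues; case: closed_field_poly_normal => r /= {1}->.
by rewrite (eqP (char_poly_monic A)) scale1r.
Qed.

Lemma size_eigenvalues (R : realType) (n : nat) (A : 'M[cplx R]_n) :
  size (eigenvalues A) = n.
Proof.
apply: succn_inj; rewrite -(size_char_poly A) eigenvaluesP.
by rewrite (size_prod_XsubC _ (fun z => z)).
Qed.

Definition cintegral (R : realType) (disp : measure_display)
    (X : measurableType disp) (mu : {measure set X -> \bar R}) (D : set X)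
    (g : X -> cplx R) : cplx R :=
  Complex (Rintegral mu D (fun x => complex.Re (g x)))
          (Rintegral mu D (fun x => complex.Im (g x))).

(* {A_i} ~_lambda f on D, the index i going to infinity along the filter F.
   The first four clauses are the standing requirements on D, f and the
   sizes d_i under which the notion is defined. *)
Definition eig_distributed (R : realType) (I : Type) (F : set_system I)
    (d : I -> nat) (A : forall i, 'M[cplx R]_(d i))
    (disp : measure_display) (X : measurableType disp)
    (mu : {measure set X -> \bar R}) (D : set X) (f : X -> cplx R) : Prop :=
  [/\ d i @[i --> F] --> \oo,
      measurable D,
      (0 < mu D < +oo)%E,
      measurable_fun D (fun x => complex.Re (f x)) /\
        measurable_fun D (fun x => complex.Im (f x))
    & forall Phi : cplx R -> cplx R,
        continuous Phi -> compact (closure [set z | Phi z != 0]) ->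
        (d i)%:R^-1 * \sum_(z <- eigenvalues (A i)) Phi z @[i --> F] -->
        rc (fine (mu D))^-1 * cintegral mu D (fun x => Phi (f x))].

Definition eig_distributed1 (R : realType) (I : Type) (F : set_system I)
    (d : I -> nat) (A : forall i, 'M[R]_(d i)) (f : R -> R) : Prop :=
  eig_distributed F (fun i => map_mx (@rc R) (A i))
    (@lebesgue_measure R) `[- pi, pi] (fun x => rc (f x)).

Definition eig_distributed2 (R : realType) (I : Type) (F : set_system I)
    (d : I -> nat) (A : forall i, 'M[R]_(d i)) (f : R * R -> R) : Prop :=
  eig_distributed F (fun i => map_mx (@rc R) (A i))
    (@lebesgue_measure R \x @lebesgue_measure R)%E
    (`[- pi, pi] `*` `[- pi, pi]) (fun x => rc (f x)).

Definition sym_posdef (R : realType) (n : nat) (A : 'M[R]_n) : Prop :=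
  A^T = A /\ forall x : 'cV[R]_n, x != 0 -> 0 < (x^T *m A *m x) 0 0.

Fixpoint gcoef (R : realType) (alpha : R) (k : nat) : R :=
  if k is k'.+1 then (1 - (alpha + 1) / k%:R) * gcoef alpha k' else 1.

(* The pairs (p, q) = (1, 0) and (p, q) = (1, -1). *)
Variant shift_pair := Shift_1_0 | Shift_1_m1.

Definition omega (R : realType) (pq : shift_pair) (alpha : R) (k : nat) : R :=
  match pq with
  | Shift_1_0 =>
      if k is k'.+1
      then alpha / 2 * gcoef alpha k + (2 - alpha) / 2 * gcoef alpha k'
      else alpha / 2 * gcoef alpha 0
  | Shift_1_m1 =>
      if k is k'.+2
      then (alpha + 2) / 4 * gcoef alpha k + (2 - alpha) / 4 * gcoef alpha k'
      else (alpha + 2) / 4 * gcoef alpha k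
  end.

Definition calG (R : realType) (pq : shift_pair) (alpha : R) (M : nat) :
    'M[R]_M :=
  \matrix_(i, j) (if (j <= i.+1)%N then omega pq alpha (i.+1 - j)%N else 0).

Definition Gmx (R : realType) (pq : shift_pair) (alpha : R) (M : nat) :
    'M[R]_M :=
  calG pq alpha M + (calG pq alpha M)^T.

Definition symbol (R : realType) (pq : shift_pair) (alpha x : R) : R :=
  2 * limn (series (fun k : nat => omega pq alpha k * cos ((k%:R - 1) * x))).

Definition hx (R : realType) (a b : R) (M : nat) : R := (b - a) / M.+1%:R.

Definition ht (R : realType) (T : R) (N : nat) : R := T / N%:R.

Definition cbar (R : realType) (alpha h : R) : R :=
  - (2 * h `^ alpha * cos (alpha * pi / 2))^-1.

(* gamma (h_t, h_x) *)
Definition gam (R : realType) (alpha k h : R) : R :=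
  - (k / (2 * h `^ alpha * cos (alpha * pi / 2))).

(* The last argument [k] is the time step h_t. *)
Definition Amx1 (R : realType) (pq : shift_pair) (eps s alpha a b : R)
    (M : nat) (k : R) : 'M[R]_M :=
  (1 + s * k)%:M
  - (eps ^+ 2 * k * cbar alpha (hx a b M)) *: Gmx pq alpha M.

(* The two space directions; [pcoord j p] is the component p_j of a pair. *)
Variant direction := Dir1 | Dir2.

Definition pcoord (X : Type) (j : direction) (p : X * X) : X :=
  match j with Dir1 => p.1 | Dir2 => p.2 end.

Definition other_dir (j : direction) : direction :=
  match j with Dir1 => Dir2 | Dir2 => Dir1 end.

Definition hxj (R : realType) (a b : R * R) (m : nat * nat) (j : direction) :
    R :=
  hx (pcoord j a) (pcoord j b) (pcoord j m).

Definition gamj (R : realType) (alpha a b : R * R) (m : nat * nat) (k : R)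
    (j : direction) : R :=
  gam (pcoord j alpha) k (hxj a b m j).

Definition gam_max (R : realType) (alpha a b : R * R) (m : nat * nat) (k : R) :
    R :=
  Num.max (gamj alpha a b m k Dir1) (gamj alpha a b m k Dir2).

Definition Amx2 (R : realType) (pq : shift_pair) (eps s : R)
    (alpha a b : R * R) (m : nat * nat) (k : R) : 'M[R]_(m.1 * m.2) :=
  (1 + s * k)%:M
  - (eps ^+ 2 * k) *:
    (tensmx (cbar alpha.1 (hxj a b m Dir1) *: Gmx pq alpha.1 m.1) 1%:M
     + tensmx 1%:M (cbar alpha.2 (hxj a b m Dir2) *: Gmx pq alpha.2 m.2)).

(* The two space steps are of the same order along a sequence [m] of grids. *)
Definition comparable_steps (R : realType) (a b : R * R)
    (m : nat -> nat * nat) : Prop :=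
  exists2 C : R, 0 < C &
    \forall n \near \oo, hxj a b (m n) Dir1 <= C * hxj a b (m n) Dir2 /\
                         hxj a b (m n) Dir2 <= C * hxj a b (m n) Dir1.

(* Main.v *)
Require Import Defs.
From HB Require Import structures.
From mathcomp Require Import all_boot all_order all_algebra.
From mathcomp Require Import all_classical all_reals all_analysis.
From mathcomp Require Import ring lra zify.
From mathcomp Require Import spectral sesquilinear measurable_realfun.

Set Implicit Arguments.
Unset Strict Implicit.
Unset Printing Implicit Defensive.

Import Order.TTheory GRing.Theory Num.Theory.
Import numFieldNormedType.Exports.

Local Open Scope classical_set_scope.
Local Open Scope ring_scope.

(** All the matrices are real symmetric, and up to vanishing corrections they
are combinations c0 I + c1 G of the identity and a Toeplitz matrix G (in the
plane: of the identity and of G1 (x) I and I (x) G2), with scalar coefficients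
that converge along the refinement.  The claims therefore reduce to the fact
that such combinations are distributed as l0 + l1 f, respectively
l0 + l1 f1(x1) + l2 f2(x2), where the l's are the limits of the c's.

The distribution follows from one comparison principle.  Let A be symmetric
with orthonormal eigenvectors u_i and eigenvalues d_i, let v_j be any
orthonormal basis and e_j any real numbers.  The numbers
w_ij = |<u_i, v_j>|^2 form a doubly stochastic matrix, and the sum of the
w_ij (d_i - e_j)^2 is the squared Frobenius norm of the residual
A V - V diag(e) ([spectral_overlap]).  A continuous function phi
with compact support satisfies |phi x - phi y| <= eps + K (x - y)^2, because it
is bounded and uniformly continuous; so the averages of phi over the d_i and
over the e_j are close as soon as the squared residual is small compared with
the dimension ([spectral_stability]).

For the v_j one takes the real form of the discrete Fourier basis, whose
entries are cas(k t_j) / sqrt n with cas = cos + sin and n equispaced nodes t_j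
in [-pi, pi], and e_j = f(t_j).  Row k of the residual only sees the
coefficients of the symbol that are cut off by the borders of the matrix, hence
is bounded by the tails of the absolutely convergent series of the weights at k
and at n - 1 - k ([toeplitz_row]); by Cesaro the squared residual is o(n)
([residual_cvg0]).  Tensor products handle the plane.  The average of
phi(f(t_j)) tends to the mean of phi o f because the nodes sample a partition
into cells of equal measure and vanishing diameter ([cell_average]).

Positive definiteness amounts to G being negative semidefinite.  Its quadratic
form is twice a combination of autocorrelations r_k of the zero-extended
vector; the weights have nonpositive sum, and off the diagonal only omega_3 can
be negative (for the pair (1, -1)), which r_0 - r_2 <= 4 (r_0 - r_1)
compensates ([Gmx_neg_semidef]).

Finally, when both space steps have the same order the larger exponent
dominates: the ratio of the two gammas behaves like a positive power of the
step ([gam_ratio_cvg0]).  For independently varying M_1 and M_2, restricting to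
the diagonal M_1 = M_2 shows that the limit belonging to the smaller exponent
is 0, while no direction carries the larger gamma on all fine grids
([no_dominant_direction]). *)

(** * Comparing the spectrum of a symmetric matrix with prescribed numbers *)

HB.instance Definition _ (R : realType) :=
  GRing.RMorphism.copy (@rc R) (real_complex R).

Section SpectralComparison.
Local Open Scope sesquilinear_scope.

Lemma mxtrace_adjmul (C : numClosedFieldType) m n (M : 'M[C]_(m, n)) :
  \tr (M^t* *m M) = \sum_i \sum_j `|M i j| ^+ 2.
Proof.
rewrite exchange_big; apply: eq_bigr => j _; rewrite mxE.
by apply: eq_bigr => i _; rewrite !mxE mulrC normCK.
Qed.

Lemma frobenius_unitary (C : numClosedFieldType) n (U X : 'M[C]_n) :
  U \is unitarymx ->
  \sum_i \sum_j `|(U *m X) i j| ^+ 2 = \sum_i \sum_j `|X i j| ^+ 2.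
Proof.
move=> uU; rewrite -!mxtrace_adjmul trmx_mul map_mxM -mulmxA (mulmxA _ U).
by rewrite -(invmx_unitary uU) mulVmx ?unitarymx_unit // mul1mx.
Qed.

Lemma unitary_row_sum (C : numClosedFieldType) n (U : 'M[C]_n) i :
  U \is unitarymx -> \sum_j `|U i j| ^+ 2 = 1.
Proof.
move=> /unitarymxP/matrixP/(_ i i); rewrite !mxE eqxx mulr1n => <-.
by apply: eq_bigr => j _; rewrite !mxE normCK.
Qed.

Lemma char_poly_similar (F : fieldType) n (P A B : 'M[F]_n) :
  P \in unitmx -> P *m A = B *m P -> char_poly A = char_poly B.
Proof.
move=> uP PA; pose Q := map_mx (@polyC F) P.
have: Q *m char_poly_mx A = char_poly_mx B *m Q.
  by rewrite mulmxBr mulmxBl -!map_mxM PA scalar_mxC.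
move/(congr1 determinant); rewrite !det_mulmx mulrC; apply: mulIf.
by rewrite det_map_mx polyC_eq0 -unitfE -unitmxE.
Qed.

Lemma eigenvalues_diagonalizable (R : realType) n (A P : 'M[cplx R]_n)
    (d : 'rV[cplx R]_n) :
  P \in unitmx -> A = invmx P *m diag_mx d *m P ->
  perm_eq (eigenvalues A) [seq d 0 i | i <- enum 'I_n].
Proof.
move=> uP defA; apply: prod_XsubC_eq; rewrite -eigenvaluesP.
rewrite (@char_poly_similar _ _ P _ (diag_mx d)) //; last first.
  by rewrite defA -!mulmxA mulKVmx.
rewrite char_poly_trig ?diag_mx_is_trig // big_map big_enum /=.
by apply: eq_bigr => i _; rewrite mxE eqxx.
Qed.

Lemma diag_commutatorE (S : comPzRingType) n (d e : 'rV[S]_n) (W : 'M[S]_n) i j :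
  (diag_mx d *m W - W *m diag_mx e) i j = (d 0 i - e 0 j) * W i j.
Proof. by rewrite mxE mul_diag_mx mul_mx_diag !mxE mulrBl [W i j * _]mulrC. Qed.

Lemma conjugated_commutator (F : fieldType) n (P A D V E : 'M[F]_n) :
  P \in unitmx -> A = invmx P *m D *m P ->
  P *m (A *m V - V *m E) = D *m (P *m V) - (P *m V) *m E.
Proof. by move=> uP ->; rewrite mulmxBr -!mulmxA mulKVmx. Qed.

(** The weights are w_ij = |<u_i, v_j>|^2 for an orthonormal eigenbasis (u_i)
and the columns v_j of V: both are orthonormal bases, whence the row and column
sums.  In the eigenbasis, entry (i, j) of the residual A V - V diag(e) is
(d_i - e_j) <u_i, v_j>, and unitary maps preserve the Frobenius norm. *)
Lemma spectral_overlap (R : realType) n (A V : 'M[R]_n) (e : 'rV[R]_n) :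
  A^T = A -> V *m V^T = 1%:M ->
  exists (d : 'I_n -> R) (w : 'I_n -> 'I_n -> R),
  [/\ perm_eq (eigenvalues (map_mx (@rc R) A)) [seq rc (d i) | i <- enum 'I_n],
      forall i j, 0 <= w i j,
      forall i, \sum_j w i j = 1,
      forall j, \sum_i w i j = 1
    & \sum_i \sum_j w i j * (d i - e 0 j) ^+ 2 =
      \sum_i \sum_j ((A *m V - V *m diag_mx e) i j) ^+ 2].
Proof.
move=> symA orthV; pose AC := map_mx (@rc R) A; pose VC := map_mx (@rc R) V.
have rc_real (x : R) : rc x \is Num.real by rewrite /rc complex_real.
have hermAC : AC \is hermsymmx.
  apply: realsym_hermsym.
    by apply/is_hermitianmxP; rewrite scale1r map_mx_id // map_trmx symA.
  by apply/mxOverP => i j; rewrite mxE.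
have /orthomx_spectralP defAC := hermitian_normalmx hermAC.
have /mxOverP sp_real := hermitian_spectral_diag_real hermAC.
have uP := spectral_unitarymx AC.
move: defAC sp_real uP; set P := spectralmx AC; set sp := spectral_diag AC.
move=> defAC sp_real uP; pose d i := complex.Re (sp 0 i).
have rcd i : rc (d i) = sp 0 i by rewrite /rc RRe_real.
have orthVC : VC \is unitarymx.
  apply/unitarymxP; have -> : VC^t* = map_mx (@rc R) V^T.
    by apply/matrixP => i j; rewrite !mxE; apply/CrealP.
  by rewrite -map_mxM orthV map_mx1.
pose W := P *m VC.
have uW : W \is unitarymx by rewrite mul_unitarymx.
have uWT : W^T \is unitarymx by rewrite trmx_unitary.
pose w i j := complex.Re (W i j) ^+ 2 + complex.Im (W i j) ^+ 2.
have rcw i j : rc (w i j) = `|W i j| ^+ 2 by rewrite /rc add_Re2_Im2.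
have rcI : injective (@rc R) by exact: complexI.
exists d, w; split.
- rewrite (eq_map rcd); apply: eigenvalues_diagonalizable defAC.
  exact: unitarymx_unit.
- by move=> i j; rewrite addr_ge0 // sqr_ge0.
- move=> i; apply: rcI; rewrite rmorph_sum rmorph1 -(unitary_row_sum i uW).
  by apply: eq_bigr => j _; exact: rcw.
- move=> j; apply: rcI; rewrite rmorph_sum rmorph1 -(unitary_row_sum j uWT).
  by apply: eq_bigr => i _; rewrite mxE -rcw.
apply: rcI; rewrite !rmorph_sum.
pose X := A *m V - V *m diag_mx e; pose XC := map_mx (@rc R) X.
have -> : \sum_i rc (\sum_j (X i j) ^+ 2) = \sum_i \sum_j `|XC i j| ^+ 2.
  apply: eq_bigr => i _; rewrite rmorph_sum; apply: eq_bigr => j _.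
  by rewrite [XC i j]mxE real_normK ?rmorphXn //; exact: rc_real.
rewrite -(frobenius_unitary XC uP); apply: eq_bigr => i _.
rewrite rmorph_sum; apply: eq_bigr => j _.
have PXC : P *m XC = diag_mx sp *m W - W *m diag_mx (map_mx (@rc R) e).
  have -> : XC = AC *m VC - VC *m diag_mx (map_mx (@rc R) e).
    by rewrite /XC map_mxB !map_mxM map_diag_mx.
  by apply: conjugated_commutator => //; exact: unitarymx_unit.
rewrite PXC diag_commutatorE -rcd [map_mx _ _ _ _]mxE normrM exprMn -rcw mulrC.
rewrite -rmorphB real_normK; last exact: rc_real.
by rewrite -rmorphXn -rmorphM mulrC.
Qed.

(** Averaging phi(d_i) - phi(e_j) against the doubly stochastic overlaps turns
the two separate sums into a single one, to which the bound on phi applies. *)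
Lemma spectral_stability (R : realType) n (A V : 'M[R]_n) (e : 'rV[R]_n)
    (phi : R -> R) (eps K : R) :
  A^T = A -> V *m V^T = 1%:M ->
  0 <= K -> (forall x y, `|phi x - phi y| <= eps + K * (x - y) ^+ 2) ->
  `|\sum_(z <- eigenvalues (map_mx (@rc R) A)) phi (complex.Re z)
    - \sum_j phi (e 0 j)|
  <= eps * n%:R
     + K * \sum_i \sum_j ((A *m V - V *m diag_mx e) i j) ^+ 2.
Proof.
move=> symA orthV K0 phiK.
have [d [w [pe w0 wr wc <-]]] := spectral_overlap e symA orthV.
have -> : \sum_(z <- eigenvalues (map_mx (@rc R) A)) phi (complex.Re z) =
    \sum_i phi (d i).
  by rewrite (perm_big _ pe) big_map big_enum.
have -> : \sum_i phi (d i) - \sum_j phi (e 0 j) =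
    \sum_i \sum_j w i j * (phi (d i) - phi (e 0 j)).
  have -> : \sum_i phi (d i) = \sum_i \sum_j w i j * phi (d i).
    by apply: eq_bigr => i _; rewrite -mulr_suml wr mul1r.
  have -> : \sum_j phi (e 0 j) = \sum_i \sum_j w i j * phi (e 0 j).
    rewrite exchange_big; apply: eq_bigr => j _.
    by rewrite -mulr_suml wc mul1r.
  rewrite -sumrB; apply: eq_bigr => i _; rewrite -sumrB.
  by apply: eq_bigr => j _; rewrite mulrBr.
have -> : eps * n%:R = \sum_i \sum_j w i j * eps.
  under eq_bigr do rewrite -mulr_suml wr mul1r.
  by rewrite sumr_const card_ord mulr_natr.
rewrite mulr_sumr -big_split; apply: le_trans (ler_norm_sum _ _ _) _.
apply: ler_sum => i _; rewrite mulr_sumr -big_split.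
apply: le_trans (ler_norm_sum _ _ _) _; apply: ler_sum => j _ /=.
by rewrite normrM ger0_norm // mulrCA -mulrDr ler_wpM2l.
Qed.

End SpectralComparison.

(** * Moduli of continuity of test functions *)
Lemma rc_pos (R : realType) (z : cplx R) :
  0 < z -> exists2 r : R, 0 < r & z = rc r.
Proof.
move=> z0; exists (complex.Re z); last by rewrite /rc RRe_real // gtr0_real.
by move: z0; rewrite ltcE => /andP[].
Qed.

Lemma rc_ge0 (R : realType) (z : cplx R) :
  0 <= z -> exists2 r : R, 0 <= r & z = rc r.
Proof.
move=> z0; exists (complex.Re z); last by rewrite /rc RRe_real // ger0_real.
by move: z0; rewrite lecE => /andP[].
Qed.

(** On the compact support Phi is bounded by some B and uniformly continuous;
at distance at least 1/(n+1) the bound 2 B is absorbed by 2 B (n+1)^2 (x - y)^2. *)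
Lemma compact_support_modulus (R : realType) (Phi : cplx R -> cplx R) :
  continuous Phi -> compact (closure [set z | Phi z != 0]) ->
  forall eps : R, 0 < eps -> exists2 K : R, 0 <= K &
  forall x y : R, `|Phi (rc x) - Phi (rc y)| <= rc (eps + K * (x - y) ^+ 2).
Proof.
move=> cPhi cK eps eps0; set S := closure _ in cK.
have PhiS z : ~ S z -> Phi z = 0.
  move=> nSz; apply/eqP; apply: contrapT => Phiz; apply: nSz.
  by apply: subset_closure; apply/negP.
have /(compact_near_coveringP _).1 covS := cK.
have nearge (r : R) : \forall n \near \oo, rc r <= n%:R.
  near=> n; rewrite -(rmorph_nat (real_complex R)) lecR.
  by near: n; exact: nbhs_infty_ger.
have [n0 _ /(_ n0 (leqnn _)) bndS] : \forall n \near \oo,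
    S `<=` [set z | `|Phi z| <= n%:R].
  apply: (covS _ \oo (fun n z => `|Phi z| <= n%:R)) => z _.
  have [r _ defr] := rc_ge0 (normr_ge0 (Phi z)).
  exists ([set z' | `|Phi z'| <= rc (r + 1)], [set n | rc (r + 1) <= n%:R]).
    split => /=; last exact: nearge.
    by apply: (cvgr_norm_le _ (cPhi z)); rewrite defr ltcR ltrDl.
  by move=> [z' n] /= [h1 h2]; exact: le_trans h2.
have [n1 _ /(_ n1 (leqnn _)) modS] : \forall n \near \oo,
    S `<=` [set z | forall z', `|z - z'| < rc n.+1%:R^-1 -> `|Phi z - Phi z'| <= rc eps].
  apply: (covS _ \oo (fun n z => forall z', `|z - z'| < rc n.+1%:R^-1 ->
    `|Phi z - Phi z'| <= rc eps)) => z _.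
  have e20 : (0 : cplx R) < rc (eps / 2) by rewrite ltcR divr_gt0.
  have /cvgrPdist_lt/(_ _ e20)/nbhs_ballP[_/posnumP[eta0] etaP] := cPhi z.
  have [eta eta_gt0 defeta] := rc_pos [gt0 of eta0%:num].
  have eta20 : (0 : cplx R) < rc (eta / 2) by rewrite ltcR divr_gt0.
  exists (ball z (rc (eta / 2)), [set n | rc (2 / eta) <= n%:R]).
    split => /=; last exact: nearge.
    by apply/nbhs_ballP; exists (rc (eta / 2)).
  move=> [z' n] /= [zz' nn] z'' z'z''.
  have hn : rc n.+1%:R^-1 <= rc (eta / 2).
    rewrite lecR -[leRHS]invrK lef_pV2 ?posrE ?invr_gt0 ?divr_gt0 //.
    rewrite invf_div; move: nn.
    rewrite -(rmorph_nat (real_complex R)) lecR => /le_trans -> //.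
    by rewrite ler_nat.
  have spl : rc eta = rc (eta / 2) + rc (eta / 2) by rewrite -rmorphD -splitr.
  have d1 : `|Phi z - Phi z'| < rc (eps / 2).
    apply: etaP; rewrite defeta spl; apply: lt_trans zz' _.
    by rewrite ltrDl.
  have d2 : `|Phi z - Phi z''| < rc (eps / 2).
    apply: etaP; rewrite /ball /= defeta spl -(subrKA z').
    apply: le_lt_trans (ler_normD _ _) _; apply: ltrD => //.
    exact: lt_le_trans hn.
  rewrite [eps]splitr rmorphD -(subrKA (Phi z)) ltW //.
  by apply: le_lt_trans (ler_normD _ _) _; apply: ltrD => //; rewrite distrC.
pose B : R := n0%:R; pose K := (2 * B) * n1.+1%:R ^+ 2.
have K0 : 0 <= K by rewrite !mulr_ge0.
have boundPhi z : `|Phi z| <= rc B.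
  rewrite [rc B](rmorph_nat (real_complex R)).
  have [/bndS//|/PhiS->] := pselect (S z).
  by rewrite normr0.
exists K => // x y.
have dxy (u v : R) : `|rc u - rc v| = rc `|u - v|.
  rewrite -rmorphB normc_def /= expr0n addr0 sqrtr_sqr //.
have [xy|xy] := ltP `|x - y| n1.+1%:R^-1.
  have le1 : rc eps <= rc (eps + K * (x - y) ^+ 2).
    by rewrite lecR lerDl mulr_ge0 // sqr_ge0.
  apply: le_trans le1; have [Sx|/PhiS Sx] := pselect (S (rc x)).
    by apply: modS => //; rewrite dxy ltcR.
  have [Sy|/PhiS Sy] := pselect (S (rc y)).
    by rewrite distrC; apply: modS => //; rewrite dxy ltcR distrC.
  by rewrite Sx Sy subrr normr0 lecR ltW.
have : `|Phi (rc x) - Phi (rc y)| <= rc B + rc B.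
  by apply: le_trans (ler_normB _ _) _; exact: lerD.
move=> /le_trans; apply; rewrite -rmorphD lecR.
have : n1.+1%:R ^- 1 ^+ 2 <= (x - y) ^+ 2.
  by rewrite -[leRHS]real_normK ?num_real // lerXn2r ?nnegrE // invr_ge0.
rewrite -(ler_pM2l (_ : 0 < n1.+1%:R ^+ 2 :> R)) ?exprn_gt0 ?ltr0Sn //.
rewrite -exprMn divff ?expr1n // => h.
have : 2 * B * 1 <= K * (x - y) ^+ 2 by rewrite /K -[leRHS]mulrA ler_wpM2l // mulr_ge0.
lra.
Unshelve. all: by end_near.
Qed.

(** For bounded functions this is uniform continuity.  The quadratic form of the
error term is what makes the Frobenius norm the right measure of a residual. *)
Definition quad_modulus (R : realType) (phi : R -> R) : Prop :=
  forall eps : R, 0 < eps -> exists2 K : R, 0 <= K &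
  forall x y : R, `|phi x - phi y| <= eps + K * (x - y) ^+ 2.

Lemma quad_modulus_continuous (R : realType) (phi : R -> R) :
  quad_modulus phi -> continuous phi.
Proof.
move=> qphi x; apply/cvgrPdist_le => eps eps0.
have eps20 : 0 < eps / 2 by rewrite divr_gt0.
have [K K0 phiK] := qphi _ eps20.
have K1 : 0 < K + 1 by rewrite ltr_wpDl.
pose del := Num.min 1 (eps / 2 / (K + 1)).
have del0 : 0 < del by rewrite lt_min ltr01 divr_gt0.
near=> y; apply: (le_trans (phiK x y)).
have xy : `|x - y| <= del by near: y; exact: cvgr_dist_le.
have : (x - y) ^+ 2 <= del.
  rewrite -real_normK ?num_real // expr2.
  rewrite -[leRHS]mul1r ler_pM // (le_trans xy) // ge_min lexx //.
move=> /(le_trans)/(_ (_ : _ <= eps / 2 / (K + 1))) h.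
have {}h : (x - y) ^+ 2 <= eps / 2 / (K + 1) by apply: h; rewrite ge_min lexx orbT.
have : K * (x - y) ^+ 2 <= eps / 2.
  apply: le_trans (_ : (K + 1) * (x - y) ^+ 2 <= _).
    by rewrite ler_wpM2r ?sqr_ge0 // lerDl.
  by rewrite mulrC -ler_pdivlMr.
lra.
Unshelve. all: by end_near. Qed.

(** * Averages over cells of equal measure *)
Lemma Rintegral_cells (R : realType) (disp : measure_display)
    (X : measurableType disp) (mu : {measure set X -> \bar R}) (D : set X)
    (n : nat) (E : 'I_n -> set X) (h : X -> R) :
  (forall j, measurable (E j)) -> trivIset setT E ->
  D = \bigcup_j E j -> mu.-integrable D (EFin \o h) ->
  Rintegral mu D h = \sum_j Rintegral mu (E j) h.
Proof.
move=> mE tE defD intD; have mD : measurable D.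
  by rewrite defD; apply: fin_bigcup_measurable.
have -> : \sum_j Rintegral mu (E j) h = fine (\sum_j \int[mu]_(x in E j) (h x)%:E).
  rewrite sum_fine // => j _; apply: integrable_fin_num => //.
  apply: integrableS intD => //; rewrite defD; exact: bigcup_sup.
congr fine; rewrite -[RHS]big_enum /=.
have defD' : D = \big[setU/set0]_(i <- enum 'I_n) E i.
  rewrite -bigcup_seq defD; apply: eq_bigcupl.
  by split => j _ //=; rewrite mem_enum.
rewrite -integral_bigsetU_EFin // -?defD' //.
- exact: enum_uniq.
- exact: sub_trivIset tE.
- exact: measurable_int intD.
Qed.

(** A Riemann sum on an arbitrary measure space: each value c_j stands for h on
a cell of measure m, so that both sides are sums over the cells of integrals of
functions that differ by at most eps. *)
Lemma cell_average (R : realType) (disp : measure_display)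
    (X : measurableType disp) (mu : {measure set X -> \bar R}) (D : set X)
    (n : nat) (E : 'I_n -> set X) (c : 'I_n -> R) (m eps : R) (h : X -> R) :
  (0 < n)%N -> 0 < m ->
  (forall j, measurable (E j)) -> trivIset setT E -> D = \bigcup_j E j ->
  (forall j, mu (E j) = m%:E) -> measurable_fun D h ->
  (forall j x, E j x -> `|c j - h x| <= eps) ->
  `|n%:R^-1 * \sum_j c j - (fine (mu D))^-1 * Rintegral mu D h| <= eps.
Proof.
move=> n0 m0 mE tE defD muE mh near_h.
have mD : measurable D by rewrite defD; apply: fin_bigcup_measurable.
have ED j : E j `<=` D by rewrite defD; exact: bigcup_sup.
have muD : mu D = (n%:R * m)%:E.
  have -> : mu D = \sum_(j < n) mu (E j).
    have defD' : D = \big[setU/set0]_(j <- index_enum 'I_n) E j.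
      rewrite -bigcup_seq defD; apply: eq_bigcupl.
      by split => j _ //=; rewrite mem_index_enum.
    have int1 A : measurable A -> (\int[mu]_(x in A) (cst (1 : R) x)%:E = mu A)%E.
      by move=> mA; exact: etrans (integral_cst mu mA 1%:E) (mul1e _).
    rewrite -int1 // defD' integral_bigsetU_EFin //.
    - by apply: eq_bigr => j _; rewrite int1.
    - exact: index_enum_uniq.
    - exact: sub_trivIset tE.
    - by apply/measurable_EFinP; exact: measurable_cst.
  by rewrite (eq_bigr (fun=> m%:E)) // sumEFin sumr_const card_ord mulr_natl.
have muD_fin : (mu D < +oo)%E by rewrite muD ltry.
have eps0 : 0 <= eps.
  have [x Ex] : E (Ordinal n0) !=set0.
    apply/set0P/negP => /eqP E0; have := muE (Ordinal n0).
    by rewrite E0 measure0 => -[] m0E; rewrite -m0E ltxx in m0.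
  exact: le_trans (normr_ge0 _) (near_h _ _ Ex).
have inth : mu.-integrable D (EFin \o h).
  apply: measurable_bounded_integrable => //.
  exists (\sum_j `|c j| + eps); split; first exact: num_real.
  move=> B /ltW ltB x Dx /=; apply: le_trans ltB.
  have : (\bigcup_j E j) x by rewrite -defD.
  move=> [j _ Ejx]; rewrite -[h x](subKr (c j)).
  apply: le_trans (ler_normB _ _) _; apply: lerD; last exact: near_h Ejx.
  by rewrite (bigD1 j) //= lerDl sumr_ge0.
have intE j : mu.-integrable (E j) (EFin \o h) by exact: integrableS (ED j) inth.
have intc j (r : R) : mu.-integrable (E j) (EFin \o cst r).
  apply: measurable_bounded_integrable => //.
    by rewrite muE ltry.
  exists `|r|; split; first exact: num_real.
  by move=> B /ltW rB x _ /=.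
have step j : `|c j * m - Rintegral mu (E j) h| <= eps * m.
  have -> : c j * m = Rintegral mu (E j) (cst (c j)).
    by rewrite Rintegral_cst // muE.
  have intB : mu.-integrable (E j) (EFin \o (fun x => c j - h x)).
    have := integrableB (mE j) (intc j (c j)) (intE j).
    by apply: eq_integrable => //.
  rewrite -(RintegralB (mE j) (intc j (c j)) (intE j)).
  apply: (le_trans (le_normr_Rintegral (mE j) intB)).
  have -> : eps * m = Rintegral mu (E j) (cst eps) by rewrite Rintegral_cst // muE.
  apply: le_Rintegral => //=; last by move=> x; exact: near_h.
  - exact: integrable_abse intB.
  - exact: intc.
have fmu : fine (mu D) = n%:R * m by rewrite muD.
have nm0 : 0 < n%:R * m by rewrite mulr_gt0 // ltr0n.
rewrite (Rintegral_cells mE tE defD inth).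
rewrite fmu.
suff -> : n%:R^-1 * \sum_j c j - (n%:R * m)^-1 * \sum_j Rintegral mu (E j) h =
   (n%:R * m)^-1 * \sum_j (c j * m - Rintegral mu (E j) h).
  have nmV0 : 0 < (n%:R * m)^-1 by rewrite invr_gt0.
  rewrite normrM (gtr0_norm nmV0) ler_pdivrMl //.
  apply: le_trans (ler_norm_sum _ _ _) _.
  apply: le_trans (ler_sum _ (fun j _ => step j)) _.
  rewrite sumr_const card_ord.
  suff -> : eps * m *+ n = n%:R * m * eps by [].
  by rewrite -mulr_natl; ring.
rewrite sumrB -mulr_suml mulrBr.
congr (_ - _); field.
by rewrite lt0r_neq0 // pnatr_eq0 -lt0n.
Qed.

Definition equal_cells (R : realType) (disp : measure_display)
    (X : measurableType disp) (mu : {measure set X -> \bar R}) (D : set X)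
    (n : nat) (E : 'I_n -> set X) : Prop :=
  [/\ forall j, measurable (E j), trivIset setT E, D = \bigcup_j E j
    & forall j, mu (E j) = (n%:R^-1 * fine (mu D))%:E].

(** * Distribution from approximate eigenbases *)
(** If the columns of V are approximate eigenvectors of A for the samples
g(p_j), in mean square, then the eigenvalues are distributed like the samples;
and these are distributed like g, as p_j represents a cell on which g is almost
constant. *)
Lemma near_eigenbasis_limit (R : realType) (I : Type) (F : set_system I)
    (FF : Filter F) (d : I -> nat) (A V : forall i, 'M[R]_(d i))
    (disp : measure_display) (X : measurableType disp)
    (mu : {measure set X -> \bar R}) (D : set X) (g : X -> R)
    (p : forall i, 'I_(d i) -> X) (E : forall i, 'I_(d i) -> set X)
    (phi : R -> R) :
  d i @[i --> F] --> \oo -> (0 < mu D < +oo)%E -> measurable_fun D g ->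
  (forall i, (A i)^T = A i) -> (forall i, V i *m (V i)^T = 1%:M) ->
  (forall i, (0 < d i)%N -> equal_cells mu D (@E i)) ->
  (forall eps : R, 0 < eps -> \forall i \near F,
     forall j x, E i j x -> `|g (p i j) - g x| <= eps) ->
  (forall eps : R, 0 < eps -> \forall i \near F,
     \sum_k \sum_j ((A i *m V i - V i *m diag_mx (\row_j g (p i j))) k j) ^+ 2
       <= eps * (d i)%:R) ->
  quad_modulus phi ->
  ((d i)%:R^-1 * \sum_(z <- eigenvalues (map_mx (@rc R) (A i))) phi (complex.Re z))
     @[i --> F] --> (fine (mu D))^-1 * Rintegral mu D (phi \o g).
Proof.
move=> dF /andP[muD0 muDoo] mg symA orthV cells mesh res qphi.
have fD : 0 < fine (mu D) by rewrite fine_gt0 // muD0.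
apply/cvgrPdist_le => eps eps0.
have eps40 : 0 < eps / 4 by rewrite divr_gt0.
have [K K0 phiK] := qphi _ eps40.
have K1 : 0 < K + 1 by rewrite ltr_wpDl.
pose del := Num.min 1 (eps / 4 / (K + 1)).
have del0 : 0 < del by rewrite lt_min ltr01 !divr_gt0.
have Kdel : K * del <= eps / 4.
  apply: le_trans (_ : (K + 1) * del <= _).
    by rewrite ler_wpM2r ?lerDl // ltW.
  by rewrite mulrC -ler_pdivlMr // ge_min lexx orbT.
near=> i.
have d0 : (0 < d i)%N by near: i; exact: (dF _ (nbhs_infty_gt 0)).
have [mE tE defD muE] := cells i d0.
have resi : \sum_k \sum_j ((A i *m V i
     - V i *m diag_mx (\row_j g (p i j))) k j) ^+ 2 <= del * (d i)%:R.
  by near: i; exact: res.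
have meshi : forall j x, E i j x -> `|g (p i j) - g x| <= del.
  by near: i; exact: mesh.
have dR : 0 < (d i)%:R :> R by rewrite ltr0n.
have := spectral_stability (\row_j g (p i j)) (symA i) (orthV i) K0 phiK.
set S := \sum_(z <- eigenvalues _) _.
set S' := \sum_j phi ((\row_j g (p i j)) 0 j) => SS'.
have {}SS' : `|(d i)%:R^-1 * S - (d i)%:R^-1 * S'| <= eps / 2.
  rewrite -mulrBr normrM gtr0_norm ?invr_gt0 // ler_pdivrMl //.
  apply: le_trans SS' _.
  have := ler_wpM2l K0 resi; have := ler_wpM2r (ltW dR) Kdel.
  move: (\sum_k _) => s; lra.
have mphi : measurable_fun D (phi \o g).
  apply: measurableT_comp => //.
  exact: continuous_measurable_fun (quad_modulus_continuous qphi).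
have m0 : 0 < (d i)%:R^-1 * fine (mu D) by rewrite mulr_gt0 ?invr_gt0.
have step j x : E i j x -> `|(phi (g (p i j))) - (phi \o g) x| <= eps / 2.
  move=> /meshi h; apply: le_trans (phiK _ _) _.
  have : (g (p i j) - g x) ^+ 2 <= del.
    rewrite -real_normK ?num_real // expr2 -[leRHS]mul1r ler_pM //.
    by rewrite (le_trans h) // ge_min lexx.
  by move=> /(ler_wpM2l K0); lra.
have := cell_average d0 m0 mE tE defD muE mphi step.
have -> : \sum_j phi (g (p i j)) = S'.
  by apply: eq_bigr => j _; rewrite mxE.
move: SS'; rewrite !ler_norml; move: (_ * S) (_ * S') (_ * Rintegral _ _ _).
by move=> s s' t /andP[h1 h2] /andP[h3 h4]; apply/andP; split; lra.
Unshelve. all: by end_near. Qed.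

(** The eigenvalues of a symmetric matrix are real, hence a complex test
function only matters through the real and imaginary parts of its restriction
to the real line, to which the real statement applies. *)
Lemma near_eigenbasis_distributed (R : realType) (I : Type) (F : set_system I)
    (FF : Filter F) (d : I -> nat) (A V : forall i, 'M[R]_(d i))
    (disp : measure_display) (X : measurableType disp)
    (mu : {measure set X -> \bar R}) (D : set X) (g : X -> R)
    (p : forall i, 'I_(d i) -> X) (E : forall i, 'I_(d i) -> set X) :
  d i @[i --> F] --> \oo -> measurable D -> (0 < mu D < +oo)%E ->
  measurable_fun D g ->
  (forall i, (A i)^T = A i) -> (forall i, V i *m (V i)^T = 1%:M) ->
  (forall i, (0 < d i)%N -> equal_cells mu D (@E i)) ->
  (forall eps : R, 0 < eps -> \forall i \near F,
     forall j x, E i j x -> `|g (p i j) - g x| <= eps) ->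
  (forall eps : R, 0 < eps -> \forall i \near F,
     \sum_k \sum_j ((A i *m V i - V i *m diag_mx (\row_j g (p i j))) k j) ^+ 2
       <= eps * (d i)%:R) ->
  eig_distributed F (fun i => map_mx (@rc R) (A i)) mu D (fun x => rc (g x)).
Proof.
move=> dF mD muD mg symA orthV cells mesh res; split => //.
move=> Phi cPhi cK.
have Re_le (z : cplx R) : `|complex.Re z| <= complex.Re `|z|.
  rewrite normc_def /= -[leLHS]sqrtr_sqr ler_sqrt ?lerDl ?sqr_ge0 //.
  by rewrite addr_ge0 ?sqr_ge0.
have Im_le (z : cplx R) : `|complex.Im z| <= complex.Re `|z|.
  rewrite normc_def /= -[leLHS]sqrtr_sqr ler_sqrt ?lerDr ?sqr_ge0 //.
  by rewrite addr_ge0 ?sqr_ge0.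
have qRe : quad_modulus (fun x => complex.Re (Phi (rc x))).
  move=> eps /(compact_support_modulus cPhi cK)[K K0 PhiK]; exists K => // x y.
  have := PhiK x y; rewrite lecE => /andP[_ /=]; apply: le_trans.
  by apply: le_trans (Re_le _); case: (Phi _) (Phi _) => [a b] [a' b'].
have qIm : quad_modulus (fun x => complex.Im (Phi (rc x))).
  move=> eps /(compact_support_modulus cPhi cK)[K K0 PhiK]; exists K => // x y.
  have := PhiK x y; rewrite lecE => /andP[_ /=]; apply: le_trans.
  by apply: le_trans (Im_le _); case: (Phi _) (Phi _) => [a b] [a' b'].
have limRe := near_eigenbasis_limit FF dF muD mg symA orthV cells mesh res qRe.
have limIm := near_eigenbasis_limit FF dF muD mg symA orthV cells mesh res qIm.
apply/cvgrPdist_lt => eps0 /rc_pos[eps e0 ->].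
have e20 : 0 < eps / 2 by rewrite divr_gt0.
have /cvgrPdist_lt/(_ _ e20) nearRe := limRe.
have /cvgrPdist_lt/(_ _ e20) nearIm := limIm.
apply: filterS2 nearRe nearIm => i.
set sRe := \sum_(z <- eigenvalues _) complex.Re _.
set sIm := \sum_(z <- eigenvalues _) complex.Im _.
have -> : \sum_(z <- eigenvalues (map_mx (@rc R) (A i))) Phi z = Complex sRe sIm.
  have [l [w [pe _ _ _ _]]] := spectral_overlap 0 (symA i) (orthV i).
  rewrite /sRe /sIm !(perm_big _ pe) !big_map /=.
  apply: (big_ind3 (fun z a b => z = Complex a b)) => //.
    by move=> z a b z' a' b' -> ->.
  by move=> j _; case: (Phi _).
have -> : (d i)%:R^-1 = rc (d i)%:R^-1 :> cplx R.
  by rewrite -(rmorph_nat (real_complex R)) -fmorphV.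
rewrite /cintegral /rc /= => hRe hIm.
have -> : forall a b c a' b' c' : R,
    (real_complex R a * Complex b c - real_complex R a' * Complex b' c') =
    Complex (a * b - a' * b') (a * c - a' * c').
  by move=> *; simpc.
rewrite [X in `|X|]complexE.
have -> : real_complex R eps = real_complex R (eps / 2) + real_complex R (eps / 2).
  by rewrite -rmorphD -splitr.
apply: le_lt_trans (ler_normD _ _) _; apply: ltrD.
  by rewrite normc_def /= expr0n addr0 sqrtr_sqr ltcR.
by rewrite normrM !normc_def /= !expr0n /= !addr0 add0r expr1n sqrtr1 mul1r sqrtr_sqr ltcR.
Qed.

(** * Equispaced nodes and cells of the circle *)
Definition node (R : realType) (n j : nat) : R := - pi + 2 * pi * (j%:R / n%:R).

(** Half-open arcs from one node to the next, except that the last one contains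
its right end point pi, so that the arcs partition the closed interval. *)
Definition arc_cell (R : realType) (n : nat) (j : 'I_n) : set R :=
  [set` Interval (BLeft (node R n j)) (BSide (j.+1 < n)%N (node R n j.+1))].

Lemma node_step (R : realType) n j :
  node R n j.+1 - node R n j = 2 * pi * n%:R^-1.
Proof. by rewrite /node -natr1; ring. Qed.

Lemma le_node (R : realType) n i j : (i <= j)%N -> node R n i <= node R n j.
Proof.
move=> ij; rewrite lerD2l ler_wpM2l ?mulr_ge0 ?pi_ge0 //.
by rewrite ler_wpM2r ?invr_ge0 // ler_nat.
Qed.

Lemma arc_cellP (R : realType) n (j : 'I_n) x : arc_cell j x ->
  node R n j <= x /\
  (if (j.+1 < n)%N then x < node R n j.+1 else x <= node R n j.+1).
Proof.
by rewrite /arc_cell /= itv_boundlr => /andP[h1 h2]; split => //; case: ifP h2.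
Qed.

Lemma arc_cell_mesh (R : realType) n (j : 'I_n) x :
  arc_cell j x -> `|node R n j - x| <= 2 * pi * n%:R^-1.
Proof.
move=> /arc_cellP[h1 h2]; rewrite distrC ger0_norm ?subr_ge0 // -(node_step R n j).
by rewrite lerD2r; case: ifP h2 => // _ /ltW.
Qed.

Lemma lebesgue_measure_circle (R : realType) :
  @lebesgue_measure R `[- pi, pi] = (2 * pi)%:E.
Proof.
rewrite lebesgue_measure_itv /= lte_fin.
have := pi_gt0 R => p0; rewrite ifT; last by lra.
by rewrite -EFinD; congr EFin; lra.
Qed.

Lemma arc_cells (R : realType) n : (0 < n)%N ->
  equal_cells (@lebesgue_measure R) `[- pi, pi] (@arc_cell R n).
Proof.
move=> n0; have nR : n%:R != 0 :> R by rewrite pnatr_eq0 -lt0n.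
have noden : node R n n = pi by rewrite /node divff // ; lra.
have node0 : node R n 0 = - pi by rewrite /node mul0r mulr0 addr0.
split.
- by move=> j; exact: measurable_itv.
- apply/trivIsetP => i j _ _ ij.
  wlog lij : i j ij / (i < j)%N.
    move=> h; have [|ji] := ltnP i j; first exact: h.
    by rewrite setIC; apply: h; rewrite 1?eq_sym // ltn_neqAle ji andbT eq_sym.
  apply/seteqP; split => // x [/arc_cellP[_ xi] /arc_cellP[xj _]].
  rewrite (leq_ltn_trans lij) // in xi.
  by have := lt_le_trans xi (le_trans (le_node _ _ lij) xj); rewrite ltxx.
- apply/seteqP; split => x; last first.
    move=> [j _ /arc_cellP[h1 h2]]; rewrite /= in_itv /= -node0 -noden.
    rewrite (le_trans (le_node _ _ (leq0n j)) h1) /=.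
    apply: le_trans (le_node _ _ (ltn_ord j)).
    by case: ifP h2 => // _ /ltW.
  rewrite /= in_itv /= => /andP[h1 h2].
  pose P k := (k < n)%N && (node R n k <= x).
  have exP : exists k, P k by exists 0%N; rewrite /P n0 node0.
  have ubP k : P k -> (k <= n)%N by move=> /andP[/ltnW].
  case: (ex_maxnP exP ubP) => k /andP[kn kx] kmax.
  exists (Ordinal kn) => //; rewrite /arc_cell /= itv_boundlr /= bnd_simp kx /=.
  case: ltnP => kn1; rewrite bnd_simp.
    by rewrite ltNge; apply/negP => h; have := kmax k.+1; rewrite /P kn1 h ltnn => /(_ isT).
  by rewrite (_ : k.+1 = n) ?noden //; apply/eqP; rewrite eqn_leq kn.
move=> j; apply: (etrans (lebesgue_measure_itv _)); rewrite /= lte_fin -subr_gt0 node_step ifT.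
  by rewrite -EFinD node_step lebesgue_measure_circle /= mulrC.
by rewrite !mulr_gt0 ?pi_gt0 // invr_gt0 ltr0n.
Qed.

Lemma equal_cells_prod (R : realType) (disp1 disp2 : measure_display)
    (X1 : measurableType disp1) (X2 : measurableType disp2)
    (mu1 : {measure set X1 -> \bar R})
    (mu2 : {sigma_finite_measure set X2 -> \bar R})
    (D1 : set X1) (D2 : set X2) n1 n2
    (E1 : 'I_n1 -> set X1) (E2 : 'I_n2 -> set X2) :
  (mu1 D1 < +oo)%E -> (mu2 D2 < +oo)%E ->
  equal_cells mu1 D1 E1 -> equal_cells mu2 D2 E2 ->
  equal_cells (mu1 \x mu2)%E (D1 `*` D2)
    (fun k : 'I_(n1 * n2) =>
       E1 (mxtens_unindex k).1 `*` E2 (mxtens_unindex k).2).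
Proof.
move=> fin1 fin2 [mE1 tE1 defD1 muE1] [mE2 tE2 defD2 muE2].
have mD1 : measurable D1 by rewrite defD1; apply: fin_bigcup_measurable.
have mD2 : measurable D2 by rewrite defD2; apply: fin_bigcup_measurable.
split.
- by move=> k; exact: measurableX.
- move=> k l _ _ [[x y] [[/= xk yk] [/= xl yl]]].
  apply: (can_inj (@mxtens_unindexK n1 n2)).
  rewrite [LHS]surjective_pairing [RHS]surjective_pairing; congr pair.
    by apply: tE1 => //; exists x.
  by apply: tE2 => //; exists y.
- apply/seteqP; split => [[x y]|[x y]].
    rewrite /= {1}defD1 {1}defD2 => -[[i _ xi] [j _ yj]].
    exists (mxtens_index (i, j)) => //.
    suff [hx hy] : E1 (mxtens_unindex (mxtens_index (i, j))).1 x /\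
        E2 (mxtens_unindex (mxtens_index (i, j))).2 y by split.
    by rewrite mxtens_indexK.
  move=> [k _ [/= xk yk]]; split => /=.
    by rewrite defD1; exists (mxtens_unindex k).1.
  by rewrite defD2; exists (mxtens_unindex k).2.
move=> k; have [mk1 mk2] := (mE1 (mxtens_unindex k).1, mE2 (mxtens_unindex k).2).
apply: (etrans (product_measure1E mu1 mu2 mk1 mk2)).
rewrite muE1 muE2 -EFinM; congr EFin.
have -> : fine ((mu1 \x mu2)%E (D1 `*` D2)) = fine (mu1 D1) * fine (mu2 D2).
  apply: etrans (congr1 fine (product_measure1E mu1 mu2 mD1 mD2)) _.
  by rewrite fineM // ge0_fin_numE.
rewrite natrM invfM; ring.
Qed.

(** * The weights of the difference formulas *)
Lemma gcoefS (R : realType) (alpha : R) k :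
  gcoef alpha k.+1 = (1 - (alpha + 1) / k.+1%:R) * gcoef alpha k.
Proof. by []. Qed.

(** The coefficients of (1 - z)^alpha are expressed with those of
(1 - z)^(alpha - 1), as for the derivative of a binomial series. *)
Lemma gcoef_shift (R : realType) (alpha : R) n :
  gcoef alpha n.+1 = - (alpha / n.+1%:R) * gcoef (alpha - 1) n.
Proof.
elim: n => [|n IH]; first by rewrite gcoefS /= !divr1; ring.
rewrite gcoefS IH [gcoef (alpha - 1) n.+1]gcoefS.
have n0 : 0 <= n%:R :> R by [].
by field; rewrite !lt0r_neq0 //; lra.
Qed.

(** Dividing (1 - z)^alpha by 1 - z sums the coefficients. *)
Lemma sum_gcoef (R : realType) (alpha : R) n :
  \sum_(k < n.+1) gcoef alpha k = gcoef (alpha - 1) n.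
Proof.
elim: n => [|n IH]; first by rewrite big_ord1.
rewrite big_ord_recr IH [gcoef alpha _](gcoef_shift alpha n) [RHS]gcoefS subrK.
by rewrite mulrBl mul1r mulNr.
Qed.

Section Coefficients.
Variables (R : realType) (alpha : R).
Hypothesis alpha12 : 1 < alpha < 2.

Lemma gcoef_ge0 k : 0 <= gcoef alpha k.+2.
Proof.
case/andP: alpha12 => a1 a2.
elim: k => [|k IH].
  rewrite !gcoefS /= !divr1.
  have -> : (1 - (alpha + 1) / 2) * ((1 - (alpha + 1)) * 1) =
            alpha * (alpha - 1) / 2 :> R by field.
  by rewrite divr_ge0 // mulr_ge0; lra.
rewrite gcoefS mulr_ge0 // subr_ge0 ler_pdivrMr ?ltr0n // mul1r.
have : (3 : R) <= k.+3%:R by rewrite ler_nat.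
lra.
Qed.

(** The partial sum is a coefficient of (1 - z)^(alpha - 1), whose sign is
opposite to that of the next coefficient of (1 - z)^alpha. *)
Lemma sum_gcoef_le0 n : \sum_(k < n.+2) gcoef alpha k <= 0.
Proof.
case/andP: alpha12 => a1 a2; have := gcoef_ge0 n.
rewrite sum_gcoef gcoef_shift mulNr oppr_ge0 pmulr_rle0 //.
by rewrite divr_gt0 ?ltr0n //; lra.
Qed.

(** Only the coefficient -alpha of index 1 is negative, so the absolute values
exceed the coefficients by 2 alpha in total. *)
Lemma sum_abs_gcoef n : \sum_(k < n) `|gcoef alpha k| <= 1 + 2 * alpha.
Proof.
case/andP: alpha12 => a1 a2.
case: n => [|[|n]]; first by rewrite big_ord0; lra.
  by rewrite big_ord1 /= normr1; lra.
have : \sum_(k < n.+2) `|gcoef alpha k| = \sum_(k < n.+2) gcoef alpha k + 2 * alpha.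
  rewrite !big_ord_recl /= !divr1 normr1.
  under eq_bigr => i _ do rewrite ger0_norm ?gcoef_ge0 //.
  by rewrite mulr1 ler0_norm; lra.
by move=> ->; have := sum_gcoef_le0 n; lra.
Qed.
End Coefficients.

(** Half of the symbol is the real part of
z^-1 (1 - z)^alpha (lam1 + lam2 z^shift) for z = e^(i x). *)
Definition shift (pq : shift_pair) : nat :=
  match pq with Shift_1_0 => 1 | Shift_1_m1 => 2 end.

Definition lam1 (R : realType) (pq : shift_pair) (alpha : R) : R :=
  match pq with Shift_1_0 => alpha / 2 | Shift_1_m1 => (alpha + 2) / 4 end.

Definition lam2 (R : realType) (pq : shift_pair) (alpha : R) : R :=
  match pq with Shift_1_0 => (2 - alpha) / 2 | Shift_1_m1 => (2 - alpha) / 4 end.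

Lemma omegaE (R : realType) pq (alpha : R) k :
  omega pq alpha k = lam1 pq alpha * gcoef alpha k
    + lam2 pq alpha * (if (shift pq <= k)%N then gcoef alpha (k - shift pq) else 0).
Proof.
case: pq; first by case: k => [|k]; rewrite /omega /= ?subSS ?subn0 // mulr0 addr0.
by case: k => [|[|k]]; rewrite /omega /= ?subSS ?subn0 // mulr0 addr0.
Qed.

Lemma sum_shifted (V : nmodType) (u : nat -> V) s n :
  \sum_(k < n) (if (s <= k)%N then u (k - s)%N else 0) = \sum_(k < n - s) u k.
Proof.
elim: n => [|n IH]; first by rewrite big_ord0 big_ord0.
rewrite big_ord_recr IH /=; case: ifP => sn.
  by rewrite subSn // big_ord_recr.
rewrite addr0; move/negbT: sn; rewrite -ltnNge => sn.
by rewrite (eqP (ltnW sn : n - s == 0)%N) (eqP (sn : n.+1 - s == 0)%N).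
Qed.

Section Weights.
Variables (R : realType) (pq : shift_pair) (alpha : R).
Hypothesis alpha12 : 1 < alpha < 2.

Lemma lam1_ge0 : 0 <= lam1 pq alpha.
Proof. by case/andP: alpha12 => a1 a2; case: pq; rewrite /lam1; lra. Qed.

Lemma lam2_ge0 : 0 <= lam2 pq alpha.
Proof. by case/andP: alpha12 => a1 a2; case: pq; rewrite /lam2; lra. Qed.

Lemma sum_omega_le0 n : (3 < n)%N -> \sum_(k < n) omega pq alpha k <= 0.
Proof.
move=> n3; under eq_bigr do rewrite omegaE.
rewrite big_split -!mulr_sumr sum_shifted /=.
case: n n3 => [|[|m]] // n3.
have [l ->] : exists l, (m.+2 - shift pq = l.+2)%N.
  by exists (m - shift pq)%N; case: pq => /=; lia.
rewrite -oppr_ge0 opprD addr_ge0 // -mulrN mulr_ge0 ?lam1_ge0 ?lam2_ge0 // oppr_ge0;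
exact: sum_gcoef_le0.
Qed.

Lemma omega_ge0 k : 0 <= omega pq alpha k.+4.
Proof.
rewrite omegaE addr_ge0 // mulr_ge0 ?lam1_ge0 ?lam2_ge0 //; first exact: gcoef_ge0.
by case: pq => /=; rewrite ?subSS ?subn0; exact: gcoef_ge0.
Qed.

Lemma sum_abs_omega_bounded :
  exists B, forall n, \sum_(k < n) `|omega pq alpha k| <= B.
Proof.
exists (lam1 pq alpha * (1 + 2 * alpha) + lam2 pq alpha * (1 + 2 * alpha)) => n.
apply: (@le_trans _ _ (\sum_(k < n) (lam1 pq alpha * `|gcoef alpha k| + lam2 pq alpha *
   (if (shift pq <= k)%N then `|gcoef alpha (k - shift pq)| else 0)))).
  apply: ler_sum => k _; rewrite omegaE; apply: le_trans (ler_normD _ _) _.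
  rewrite !normrM (ger0_norm lam1_ge0) (ger0_norm lam2_ge0) lerD2l.
  by case: ifP; rewrite ?normr0.
rewrite big_split -!mulr_sumr /= (sum_shifted (fun k => `|gcoef alpha k|)).
by apply: lerD; apply: ler_wpM2l; rewrite ?lam1_ge0 ?lam2_ge0 ?sum_abs_gcoef.
Qed.

(** These are the two inequalities needed to compensate omega_3, which is
negative for the pair (1, -1).  In that case the second expression vanishes
at alpha = 1; the factor alpha - 1 is split off and the rest is
written with nonnegative terms in alpha - 1 and 2 - alpha. *)
Lemma omega_off_diagonal :
  0 <= omega pq alpha 0 + omega pq alpha 2 /\
  0 <= omega pq alpha 0 + omega pq alpha 2 + 4 * omega pq alpha 3.
Proof.
case/andP: alpha12 => a1 a2.
have a0 : 0 < alpha by apply: lt_trans a1.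
have b0 : 0 < alpha - 1 by rewrite subr_gt0.
have c0 : 0 < 2 - alpha by rewrite subr_gt0.
case: pq.
  have -> : omega Shift_1_0 alpha 0 + omega Shift_1_0 alpha 2 =
    alpha * (alpha - 1) * (alpha + 2) / 4 by rewrite /omega /=; field.
  have -> : omega Shift_1_0 alpha 3 =
    alpha * (alpha - 1) * (2 - alpha) * (alpha + 3) / 12.
    by rewrite /omega /=; field.
  by split; repeat first
    [exact: ltW | done | apply: addr_ge0 | apply: divr_ge0 | apply: mulr_ge0].
have -> : omega Shift_1_m1 alpha 0 + omega Shift_1_m1 alpha 2 =
  alpha * (alpha - 1) * (alpha + 2) / 8 + 1 by rewrite /omega /=; field.
split; first by repeat first
    [exact: ltW | done | apply: addr_ge0 | apply: divr_ge0 | apply: mulr_ge0].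
have -> : alpha * (alpha - 1) * (alpha + 2) / 8 + 1 + 4 * omega Shift_1_m1 alpha 3 =
  (alpha - 1) * (21 + 27 * (alpha - 1) + 9 * ((alpha - 1) * (2 - alpha))
     + 4 * ((alpha - 1) * (2 - alpha) * alpha)) / 24 by rewrite /omega /=; field.
by repeat first
    [exact: ltW | done | apply: addr_ge0 | apply: divr_ge0 | apply: mulr_ge0].
Qed.
End Weights.

(** * Symbols with absolutely summable coefficients *)
Section SummableWeights.
Variables (R : realType) (w : nat -> R) (B : R).
Hypothesis w_bounded : forall n, \sum_(k < n) `|w k| <= B.

Lemma cvg_abs_weights : cvgn (series (fun k => `|w k|)).
Proof.
apply: nondecreasing_is_cvgn; first exact: nondecreasing_series.
by exists B => _ [n _ <-]; rewrite /series /= big_mkord.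
Qed.

Definition wtail (k : nat) : R :=
  limn (series (fun m => `|w m|)) - \sum_(m < k) `|w m|.

Lemma wtailE k : wtail k = limn (series (fun m => `|w m|)) - series (fun m => `|w m|) k.
Proof. by rewrite /wtail /series /= big_mkord. Qed.

Lemma sum_le_wtail k n : (k <= n)%N -> \sum_(k <= m < n) `|w m| <= wtail k.
Proof.
move=> kn; rewrite wtailE lerBrDl /series /= -big_cat_nat //.
rewrite -[leLHS]/(series (fun m => `|w m|) n).
by apply: nondecreasing_cvgn_le; [exact: nondecreasing_series | exact: cvg_abs_weights].
Qed.

Lemma wtail_ge0 k : 0 <= wtail k.
Proof. by have := sum_le_wtail (leqnn k); rewrite big_geq. Qed.

Lemma wtail_le k n : (k <= n)%N -> wtail n <= wtail k.
Proof.
move=> kn; rewrite !wtailE lerD2l lerN2.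
exact: nondecreasing_series.
Qed.

Lemma wtail_cvg0 : wtail n @[n --> \oo] --> 0.
Proof.
under eq_fun do rewrite wtailE.
rewrite -(subrr (limn (series (fun m => `|w m|)))).
by apply: cvgB; [exact: cvg_cst | exact: cvg_abs_weights].
Qed.

Definition wsymbol (x : R) : R :=
  2 * limn (series (fun k : nat => w k * cos ((k%:R - 1) * x))).

Lemma wsymbol_trunc x n :
  `|wsymbol x - 2 * \sum_(k < n) w k * cos ((k%:R - 1) * x)| <= 2 * wtail n.
Proof.
pose u k := w k * cos ((k%:R - 1) * x).
have u_le k : `|u k| <= `|w k| by rewrite normrM ler_piMr // cos_max.
have cu : cvgn (series u).
  by apply: normed_cvg; apply: series_le_cvg cvg_abs_weights => //= k.
rewrite /wsymbol -mulrBr normrM ger0_norm // ler_wpM2l //.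
have lim_u : `|series u N - series u n| @[N --> \oo] --> `|limn (series u) - series u n|.
  by apply: cvg_norm; apply: cvgB => //; exact: cvg_cst.
have -> : \sum_(k < n) w k * cos ((k%:R - 1) * x) = series u n.
  by rewrite /series /= big_mkord.
apply: (cvgr_to_le lim_u); near=> N.
have nN : (n <= N)%N by near: N; exact: nbhs_infty_ge.
rewrite sub_series nN; apply: le_trans (sum_le_wtail nN).
apply: le_trans (ler_norm_sum _ _ _) _; apply: ler_sum => k _; exact: u_le.
Unshelve. all: by end_near. Qed.

Lemma cos_lipschitz (x y : R) : `|cos x - cos y| <= `|x - y|.
Proof.
wlog yx : x y / y <= x.
  move=> h; have [/h//|/ltW/h] := leP y x.
  by rewrite distrC (distrC y).
have [c _ ->] : exists2 c, c \in `[y, x] & cos x - cos y = - sin c * (x - y).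
  apply: (@MVT_segment _ cos (fun c => - sin c)) => //.
  by apply: continuous_subspaceT => z; exact: continuous_cos.
by rewrite normrM normrN ler_piMl // sin_max.
Qed.

(** A trigonometric polynomial is Lipschitz and the truncation error is uniform. *)
Lemma wsymbol_unif (eps : R) : 0 < eps -> exists2 del, 0 < del &
  forall x y, `|x - y| <= del -> `|wsymbol x - wsymbol y| <= eps.
Proof.
move=> e0; have e8 : 0 < eps / 8 by rewrite divr_gt0.
have /cvgrPdist_le/(_ _ e8)[n _ /(_ n (leqnn _))] := wtail_cvg0.
rewrite sub0r normrN ger0_norm ?wtail_ge0 // => tn.
pose L := \sum_(k < n) `|w k| * `|k%:R - 1|.
have L0 : 0 <= L by apply: sumr_ge0 => k _; rewrite mulr_ge0.
have L1 : 0 < L + 1 by rewrite ltr_wpDl.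
exists (eps / 4 / (L + 1)); first by rewrite !divr_gt0.
move=> x y xy.
have hx := wsymbol_trunc x n; have hy := wsymbol_trunc y n.
set Sx := \sum_(k < n) _ in hx; set Sy := \sum_(k < n) _ in hy.
have Sxy : `|Sx - Sy| <= eps / 4.
  apply: (@le_trans _ _ (L * `|x - y|)).
    rewrite -sumrB mulr_suml; apply: le_trans (ler_norm_sum _ _ _) _.
    apply: ler_sum => k _; rewrite -mulrBr normrM -mulrA ler_wpM2l //.
    by rewrite -normrM mulrBr; exact: cos_lipschitz.
  apply: (@le_trans _ _ ((L + 1) * `|x - y|)).
    by rewrite ler_wpM2r // lerDl.
  by rewrite mulrC -ler_pdivlMr.
move: hx hy Sxy; rewrite !ler_norml; move: (wsymbol x) (wsymbol y) => a b.
by move=> /andP[h1 h2] /andP[h3 h4] /andP[h5 h6]; apply/andP; split; lra.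
Qed.
End SummableWeights.

(** * The discrete Hartley basis *)
(** The kernel of the Hartley transform: the real vectors cas(k t) play the role
of e^(i k t), because a symmetric filter multiplies them by its real symbol
([cas_sum_diff]). *)
Definition cas (R : realType) (x : R) : R := cos x + sin x.

Lemma abs_cas_le2 (R : realType) (x : R) : `|cas x| <= 2.
Proof.
apply: le_trans (ler_normD _ _) _.
by have := cos_max x; have := sin_max x; lra.
Qed.

Lemma cas_sum_diff (R : realType) (x y : R) :
  cas (x + y) + cas (x - y) = 2 * cos y * cas x.
Proof. by rewrite /cas !cosD !sinD cosN sinN; ring. Qed.

Lemma cas_mul (R : realType) (x y : R) :
  cas x * cas y = cos (x - y) + sin (x + y).
Proof. by rewrite /cas cosB sinD; ring. Qed.

Lemma node0 (R : realType) n : node R n 0 = - pi.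
Proof. by rewrite /node mul0r mulr0 addr0. Qed.

Lemma sin_mulr_pi (R : realType) m : sin (m%:R * pi) = 0 :> R.
Proof.
elim: m => [|m IH]; first by rewrite mul0r sin0.
by rewrite -natr1 mulrDl mul1r sinDpi IH oppr0.
Qed.

Lemma sin_mulr_pi_neq0 (R : realType) m n : (0 < m < n)%N ->
  sin (m%:R * (pi / n%:R)) != 0 :> R.
Proof.
case/andP=> m0 mn; have n0 : (0 < n)%N by exact: leq_trans mn.
rewrite gt_eqF // sin_gt0_pi // mulr_gt0 ?divr_gt0 ?pi_gt0 ?ltr0n //=.
rewrite mulrCA gtr_pMr ?pi_gt0 // ltr_pdivrMr ?ltr0n // mul1r ltr_nat //.
Qed.

(** Multiplied by 2 sin(m pi / n), the sum telescopes around the circle. *)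
Lemma sum_cos_nodes (R : realType) n m : (0 < m < n)%N ->
  \sum_(j < n) cos (m%:R * node R n j) = 0.
Proof.
move=> mn; have s0 := sin_mulr_pi_neq0 R mn.
have n0 : (0 < n)%N by case/andP: mn => [_ /(leq_trans _)]; apply.
have nR : n%:R != 0 :> R by rewrite pnatr_eq0 -lt0n.
set y := _ * (pi / _) in s0.
pose h j := sin (m%:R * node R n j - y).
have step j : 2 * sin y * cos (m%:R * node R n j) = h j.+1 - h j.
  have -> : h j.+1 = sin (m%:R * node R n j + y).
    rewrite /h; congr sin; rewrite -[node R n j.+1](subrK (node R n j)) node_step.
    by rewrite /y; ring.
  by rewrite /h sinD sinB; ring.
apply: (mulfI s0); apply: (mulfI (_ : 2 != 0 :> R)); first by [].
rewrite !mulr0 mulrA mulr_sumr; under eq_bigr do rewrite step.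
rewrite -(big_mkord predT (fun j => h j.+1 - h j)) telescope_sumr // /h.
have -> : m%:R * node R n n - y = m%:R * node R n 0 - y + pi *+ 2 *+ m.
  rewrite /node mul0r divff // -(mulr_natl (pi *+ 2) m) -(mulr_natl pi 2); ring.
by rewrite periodicn ?subrr //; exact: sinD2pi.
Qed.

(** Apart from -pi, where the sine vanishes, the nodes are symmetric about 0. *)
Lemma sum_sin_nodes (R : realType) n m :
  \sum_(j < n) sin (m%:R * node R n j) = 0.
Proof.
case: n => [|n]; first by rewrite big_ord0.
rewrite big_ord_recl /= node0 mulrN sinN sin_mulr_pi oppr0 add0r.
set S := \sum_(_ < _) _.
suff : S = - S by lra.
rewrite {1}/S (reindex_inj rev_ord_inj) -sumrN; apply: eq_bigr => j _ /=.
rewrite -sinN; congr sin; rewrite -mulrN; congr (_ * _).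
rewrite /node /bump /= !natrD natrB ?ltn_ord //.
have n0 : 0 <= n%:R :> R by [].
by field; rewrite lt0r_neq0 //; lra.
Qed.

Definition hartley (R : realType) (n : nat) : 'M[R]_n :=
  \matrix_(k, j) (Num.sqrt n%:R^-1 * cas (k%:R * node R n j)).

Lemma hartley_orthogonal (R : realType) n : hartley R n *m (hartley R n)^T = 1%:M.
Proof.
apply/matrixP => k l; rewrite !mxE.
have n0 : (0 < n)%N by exact: leq_ltn_trans (ltn_ord k).
have nR : n%:R != 0 :> R by rewrite pnatr_eq0 -lt0n.
transitivity (n%:R^-1 * \sum_(j < n) (cos ((k%:R - l%:R) * node R n j) +
    sin ((k + l)%:R * node R n j))).
  rewrite mulr_sumr; apply: eq_bigr => j _; rewrite !mxE mulrACA cas_mul.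
  by rewrite -expr2 sqr_sqrtr ?invr_ge0 // mulrBl natrD mulrDl.
rewrite big_split /= sum_sin_nodes addr0.
have [->|kl] := eqVneq k l.
  under eq_bigr do rewrite subrr mul0r cos0.
  by rewrite sumr_const card_ord mulVf.
rewrite (_ : \sum_(j < n) _ = 0) ?mulr0 //.
wlog lk : k l kl / (l < k)%N.
  move=> h; have [kl'|lk|/val_inj kl'] := ltngtP k l; last by rewrite kl' eqxx in kl.
    rewrite -[RHS](h l k) //; last by rewrite eq_sym.
    by apply: eq_bigr => j _; rewrite -cosN -mulNr opprB.
  exact: h.
rewrite -natrB ?(ltnW lk) //; apply: sum_cos_nodes.
by rewrite subn_gt0 lk /= (leq_ltn_trans (leq_subr _ _)).
Qed.

(** * Toeplitz matrices acting on the Hartley basis *)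
Lemma sum_pick (S : pzSemiRingType) K (u : nat -> S) (a b : nat) :
  \sum_(m < K) (m + a == b)%N%:R * u m =
  if (a <= b)%N && (b - a < K)%N then u (b - a)%N else 0.
Proof.
case: ifP => [/andP[ab bK]|nab].
  rewrite (bigD1 (Ordinal bK)) //= subnK // eqxx mul1r big1 ?addr0 // => m mb.
  rewrite (_ : (m + a == b)%N = false) ?mul0r //; apply/negbTE.
  apply: contra mb => /eqP mab; apply/eqP/val_inj => /=; lia.
rewrite big1 // => m _; rewrite (_ : (m + a == b)%N = false) ?mul0r //.
by apply/negP => /eqP mab; move: nab; have := ltn_ord m; lia.
Qed.

(** Written this way the truncation by the borders of the matrix is carried by
the summation over the column index, not by case distinctions. *)
Lemma GmxE (R : realType) pq (alpha : R) M K (i j : 'I_M) : (M < K)%N ->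
  Gmx pq alpha M i j = \sum_(m < K) omega pq alpha m *
    ((m + j == i.+1)%N%:R + (m + i == j.+1)%N%:R).
Proof.
move=> MK; have iM := ltn_ord i; have jM := ltn_ord j.
under eq_bigr do rewrite mulrDr mulrC [X in _ + X]mulrC.
rewrite big_split /= !sum_pick !mxE.
have iK (l : nat) : (i.+1 - l < K)%N by
  exact: leq_ltn_trans (leq_subr _ _) (leq_ltn_trans iM MK).
have jK (l : nat) : (j.+1 - l < K)%N by
  exact: leq_ltn_trans (leq_subr _ _) (leq_ltn_trans jM MK).
by rewrite iK jK !andbT.
Qed.

Section ToeplitzResidual.
Variables (R : realType) (pq : shift_pair) (alpha : R) (B : R).
Local Notation w := (omega pq alpha).
Hypothesis w_bounded : forall n, \sum_(k < n) `|w k| <= B.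

(** Weight m reaches from row k to the columns k + 1 - m and k - 1 + m.  If both
lie inside the matrix, its contribution to the residual vanishes by
[cas_sum_diff]; otherwise m >= k or m >= M - 1 - k, and the contribution is at
most 8 |w m|. *)
Lemma toeplitz_row (M : nat) (k : 'I_M) (x : R) :
  `|\sum_(l < M) Gmx pq alpha M k l * cas (l%:R * x)
    - wsymbol w x * cas (k%:R * x)| <=
  12 * (wtail w k + wtail w (M - k.+1)).
Proof.
have kM := ltn_ord k.
pose u l := cas (l%:R * x).
(* The contribution of weight m inside the matrix. *)
pose c m := (if (m <= k.+1)%N && (k.+1 - m < M)%N then u (k.+1 - m)%N else 0) +
            (if (0 < m + k)%N && (m + k - 1 < M)%N then u (m + k - 1)%N else 0).
have -> : \sum_(l < M) Gmx pq alpha M k l * cas (l%:R * x) =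
    \sum_(m < M.+1) w m * c m.
  under eq_bigr => l _ do rewrite (GmxE _ _ _ _ (ltnSn M)) mulr_suml.
  rewrite exchange_big; apply: eq_bigr => m _ /=.
  rewrite /c -!(sum_pick _ u) -big_split mulr_sumr; apply: eq_bigr => l _ /=.
  by rewrite -mulrA mulrDl (addnC m l) (eq_sym (m + k)%N) (addn1 l).
(* The contribution of weight m in a bi-infinite Toeplitz matrix. *)
pose e m := 2 * cos ((m%:R - 1) * x) * u k.
have c_le m : `|c m| <= 4.
  have bu b l : `|if b then u l else 0| <= 2.
    by case: b; rewrite ?normr0 // abs_cas_le2.
  by apply: le_trans (ler_normD _ _) _; rewrite (_ : 4 = 2 + 2) ?lerD //; ring.
have e_le m : `|e m| <= 4.
  rewrite /e !normrM ger0_norm // (_ : 4 = 2 * 1 * 2); last by ring.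
  by rewrite !ler_pM ?mulr_ge0 ?cos_max ?abs_cas_le2.
have term m : `|c m - e m| <= 8 * ((k <= m)%N%:R + (M - k.+1 <= m)%N%:R).
  have far : (k <= m)%N || (M - k.+1 <= m)%N ->
      `|c m - e m| <= 8 * ((k <= m)%N%:R + (M - k.+1 <= m)%N%:R).
    move=> km; apply: (le_trans (ler_normB _ _)).
    apply: (@le_trans _ _ 8); first by have := c_le m; have := e_le m; lra.
    by move: km; do 2 case: (_ <= _)%N => //=; lra.
  have [/far//|] := boolP ((k <= m)%N || (M - k.+1 <= m)%N).
  rewrite negb_or -!ltnNge => /andP[mk mk2].
  rewrite (_ : c m = e m) ?subrr ?normr0; first by rewrite mulr_ge0 // addr_ge0.
  rewrite /c /e !ifT; try by lia.
  rewrite /u -cas_sum_diff addrC; congr (cas _ + cas _).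
    by rewrite natrB ?natrD; [ring | lia].
  by rewrite natrB -?natr1; [ring | lia].
have main : `|\sum_(m < M.+1) w m * c m - \sum_(m < M.+1) w m * e m| <=
    8 * (wtail w k + wtail w (M - k.+1)).
  have tailE a : (a <= M.+1)%N ->
      \sum_(m < M.+1) `|w m| * (a <= m)%N%:R <= wtail w a.
    move=> aM; apply: le_trans (sum_le_wtail w_bounded aM).
    rewrite -(big_mkord predT (fun m => `|w m| * (a <= m)%N%:R)).
    rewrite (big_cat_nat _ aM) //= big_nat big1 ?add0r => [|m /andP[_ ma]].
      rewrite big_nat [leRHS]big_nat; apply: ler_sum => m /andP[am _].
      by rewrite am mulr1.
    by rewrite leqNgt ma mulr0.
  rewrite -sumrB; apply: le_trans (ler_norm_sum _ _ _) _.
  apply: (@le_trans _ _ (\sum_(m < M.+1)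
     8 * (`|w m| * (k <= m)%N%:R + `|w m| * (M - k.+1 <= m)%N%:R))).
    apply: ler_sum => m _; rewrite -mulrBr normrM -mulrDr mulrCA.
    by rewrite ler_wpM2l.
  rewrite -mulr_sumr big_split /= ler_wpM2l // lerD // tailE //; lia.
have last : `|\sum_(m < M.+1) w m * e m - wsymbol w x * u k| <= 4 * wtail w k.
  have -> : \sum_(m < M.+1) w m * e m =
      2 * (\sum_(m < M.+1) w m * cos ((m%:R - 1) * x)) * u k.
    rewrite mulr_sumr mulr_suml; apply: eq_bigr => m _; rewrite /e; ring.
  rewrite -mulrBl normrM distrC (_ : 4 * wtail w k = 2 * wtail w k * 2); last by ring.
  rewrite ler_pM ?abs_cas_le2 //.
  apply: le_trans (wsymbol_trunc w_bounded x M.+1) _.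
  by rewrite ler_wpM2l // wtail_le //; lia.
have t0 := wtail_ge0 w_bounded (M - k.+1).
rewrite -(subrKA (\sum_(m < M.+1) w m * e m)) -/(u k).
apply: le_trans (ler_normD _ _) _; lra.
Qed.
End ToeplitzResidual.

(** * The residual in Frobenius norm *)
Definition frob2 (R : pzRingType) m n (X : 'M[R]_(m, n)) : R :=
  \sum_i \sum_j X i j ^+ 2.

Lemma frob2_ge0 (R : realType) m n (X : 'M[R]_(m, n)) : 0 <= frob2 X.
Proof. by apply: sumr_ge0 => i _; apply: sumr_ge0 => j _; exact: sqr_ge0. Qed.

Lemma frob2D (R : realType) m n (X Y : 'M[R]_(m, n)) :
  frob2 (X + Y) <= 2 * frob2 X + 2 * frob2 Y.
Proof.
rewrite /frob2 !mulr_sumr -big_split; apply: ler_sum => i _ /=.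
rewrite !mulr_sumr -big_split; apply: ler_sum => j _ /=.
by rewrite mxE -subr_ge0 [leRHS](_ : _ = (X i j - Y i j) ^+ 2) ?sqr_ge0 //; ring.
Qed.

Lemma frob2Z (R : realType) m n c (X : 'M[R]_(m, n)) :
  frob2 (c *: X) = c ^+ 2 * frob2 X.
Proof.
rewrite /frob2 !mulr_sumr; apply: eq_bigr => i _; rewrite mulr_sumr.
by apply: eq_bigr => j _; rewrite mxE exprMn.
Qed.

Lemma sum_mxtens (V : nmodType) m n (h : 'I_(m * n) -> V) :
  \sum_k h k = \sum_i \sum_j h (mxtens_index (i, j)).
Proof.
rewrite pair_big /= (reindex (@mxtens_index m n)) /=.
  by apply: eq_bigr => -[].
by exists (@mxtens_unindex m n) => k _; [exact: mxtens_indexK | exact: mxtens_unindexK].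
Qed.

Lemma frob2_tens (R : realType) m1 n1 m2 n2
    (X : 'M[R]_(m1, n1)) (Y : 'M[R]_(m2, n2)) :
  frob2 (tensmx X Y) = frob2 X * frob2 Y.
Proof.
rewrite /frob2 sum_mxtens mulr_suml; apply: eq_bigr => i _.
rewrite mulr_sumr; apply: eq_bigr => j _.
rewrite sum_mxtens big_distrlr; apply: eq_bigr => k _; apply: eq_bigr => l _ /=.
by rewrite tensmxE exprMn.
Qed.

Lemma frob2_orthogonal (R : realType) n (V : 'M[R]_n) (e : 'rV[R]_n) (b : R) :
  V *m V^T = 1%:M -> (forall j, e 0 j ^+ 2 <= b) ->
  frob2 (V *m diag_mx e) <= b * n%:R.
Proof.
move=> /mulmx1C VV eb; rewrite /frob2 exchange_big.
have -> : b * n%:R = \sum_(j < n) b by rewrite sumr_const card_ord mulr_natr.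
apply: ler_sum => j _.
under eq_bigr => i _ do rewrite mul_mx_diag mxE exprMn mulrC.
rewrite -mulr_sumr (_ : \sum_i V i j ^+ 2 = 1) ?mulr1 //.
have := congr1 (fun X : 'M[R]_n => X j j) VV; rewrite !mxE eqxx mulr1n => <-.
by apply: eq_bigr => i _; rewrite mxE.
Qed.

Section Residual.
Variables (R : realType) (pq : shift_pair) (alpha : R).
Hypothesis alpha12 : 1 < alpha < 2.
Local Notation w := (omega pq alpha).
Local Notation f := (symbol pq alpha).

Definition node_values n : 'rV[R]_n := \row_j f (node R n j).

Definition residual n : 'M[R]_n :=
  Gmx pq alpha n *m hartley R n - hartley R n *m diag_mx (node_values n).

Lemma residualE n k j : residual n k j =
  Num.sqrt n%:R^-1 * (\sum_(l < n) Gmx pq alpha n k l * cas (l%:R * node R n j)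
     - f (node R n j) * cas (k%:R * node R n j)).
Proof.
rewrite mxE mxE [X in _ + X]mxE mul_mx_diag !mxE mulrBr; congr (_ - _); last by ring.
by rewrite mulr_sumr; apply: eq_bigr => l _; rewrite [hartley _ _ _ _]mxE; ring.
Qed.

Lemma frob2_residual_le n :
  frob2 (residual n) <= 576 * \sum_(k < n) wtail w k ^+ 2.
Proof.
have [B wB] := sum_abs_omega_bounded pq alpha12.
case: n => [|n]; first by rewrite /frob2 !big_ord0 mulr0.
pose t k := wtail w k.
have t0 k : 0 <= t k by exact: wtail_ge0 wB k.
apply: (@le_trans _ _ (\sum_(k < n.+1) 144 * (2 * t k ^+ 2 + 2 * t (n.+1 - k.+1)%N ^+ 2))).
  apply: ler_sum => k _.
  apply: (@le_trans _ _ (\sum_(j < n.+1) n.+1%:R^-1 * (144 * (2 * t k ^+ 2 + 2 * t (n.+1 - k.+1)%N ^+ 2)))).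
    apply: ler_sum => j _; rewrite residualE exprMn sqr_sqrtr ?invr_ge0 //.
    rewrite ler_wpM2l ?invr_ge0 // -real_normK ?num_real //.
    apply: (@le_trans _ _ ((12 * (t k + t (n.+1 - k.+1)%N)) ^+ 2)).
      have row := toeplitz_row wB k (node R n.+1 j).
      apply: lerXn2r row; rewrite nnegrE; first exact: normr_ge0.
      by apply: mulr_ge0 => //; apply: addr_ge0; exact: t0.
    rewrite -subr_ge0 [leRHS](_ : _ = 144 * (t k - t (n.+1 - k.+1)%N) ^+ 2).
      by rewrite mulr_ge0 // sqr_ge0.
    by ring.
  rewrite sumr_const card_ord; set y := 144 * _.
  have nM (x : R) : x *+ n.+1 = n.+1%:R * x by rewrite mulr_natl.
  by rewrite nM mulVKf.
rewrite -mulr_sumr big_split /= -!mulr_sumr.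
have -> : \sum_(k < n.+1) t (n.+1 - k.+1)%N ^+ 2 = \sum_(k < n.+1) t k ^+ 2.
  by rewrite [RHS](reindex_inj rev_ord_inj).
by rewrite /t; lra.
Qed.

(** The squared residual is at most a constant times the sum of the squared
tails, whose Cesaro means tend to 0. *)
Lemma residual_cvg0 : frob2 (residual n) / n%:R @[n --> \oo] --> 0.
Proof.
have [B wB] := sum_abs_omega_bounded pq alpha12.
rewrite -(cvg_shiftS (fun n => frob2 (residual n) / n%:R)).
have t0 : (wtail w n ^+ 2) @[n --> \oo] --> 0.
  under eq_fun do rewrite expr2.
  have h := cvgM (wtail_cvg0 wB) (wtail_cvg0 wB).
  by rewrite mulr0 in h; apply: h.
have : (576 : R) * arithmetic_mean (fun n => wtail w n ^+ 2) n @[n --> \oo] --> 0.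
  have h := cvgM (cvg_cst (576 : R)) (cesaro t0).
  by rewrite mulr0 in h; apply: h.
apply: squeeze_cvgr; last exact: cvg_cst.
apply: nearW => n /=; rewrite divr_ge0 ?frob2_ge0 //= ler_pdivrMr //.
apply: le_trans (frob2_residual_le _) _.
rewrite /arithmetic_mean /series /= big_mkord.
set S := \sum_(k < n.+1) _; have n0 : n.+1%:R != 0 :> R by [].
by rewrite -!mulrA [S * _]mulrC mulKf.
Qed.

Lemma symbol_unif (eps : R) : 0 < eps -> exists2 del, 0 < del &
  forall x y, `|x - y| <= del -> `|f x - f y| <= eps.
Proof.
have [B wB] := sum_abs_omega_bounded pq alpha12; exact: (wsymbol_unif wB).
Qed.

Lemma symbol_continuous : continuous (f : R -> R).
Proof.
move=> x; apply/cvgrPdist_le => eps /symbol_unif[del del0 delP].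
by near=> y; apply: delP; near: y; exact: cvgr_dist_le.
Unshelve. all: by end_near. Qed.

Lemma symbol_measurable : measurable_fun setT f.
Proof. exact: continuous_measurable_fun symbol_continuous. Qed.

Lemma symbol_bounded : exists2 L, 0 <= L & forall x, `|f x| <= L.
Proof.
have [B wB] := sum_abs_omega_bounded pq alpha12.
exists (2 * wtail w 0) => [|x]; first by rewrite mulr_ge0 // (wtail_ge0 wB).
by have := wsymbol_trunc wB x 0; rewrite big_ord0 mulr0 subr0.
Qed.

Lemma Gmx_sym n : (Gmx pq alpha n)^T = Gmx pq alpha n.
Proof. by rewrite /Gmx linearD /= trmxK addrC. Qed.
End Residual.

(** * Distribution of shifted and scaled Toeplitz matrices *)
Lemma frob2_perturbed (R : realType) n (X Y V : 'M[R]_n) (e : 'rV[R]_n) (b : R) :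
  V *m V^T = 1%:M -> X = Y + V *m diag_mx e -> (forall j, `|e 0 j| <= b) ->
  frob2 X <= 2 * frob2 Y + 2 * b ^+ 2 * n%:R.
Proof.
move=> orthV -> eb; apply: le_trans (frob2D _ _) _; rewrite lerD2l -mulrA ler_wpM2l //.
apply: frob2_orthogonal => // j; rewrite -real_normK ?num_real //.
by apply: lerXn2r; rewrite ?nnegrE // (le_trans _ (eb j)).
Qed.

Lemma mesh_small (R : realType) (del : R) : 0 < del ->
  \forall n \near \oo, 2 * pi * n%:R^-1 <= del.
Proof.
move=> del0; near=> n.
have n0 : (0 < n)%N by near: n; exact: nbhs_infty_gt.
rewrite ler_pdivrMr ?ltr0n // [del * _]mulrC -ler_pdivrMr //.
by near: n; exact: nbhs_infty_ger.
Unshelve. all: by end_near. Qed.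

Section Distribution.
Variables (R : realType) (pq : shift_pair) (I : Type) (F : set_system I).
Hypothesis FF : Filter F.

Lemma symbol_mesh (alpha l eps : R) (d : I -> nat) : 1 < alpha < 2 -> 0 < eps ->
  d i @[i --> F] --> \oo ->
  \forall i \near F, forall (j : 'I_(d i)) x, arc_cell j x ->
    `|l * symbol pq alpha (node R (d i) j) - l * symbol pq alpha x| <= eps.
Proof.
move=> a12 e0 dF; have l1 : 0 < `|l| + 1 by rewrite ltr_wpDl.
have [del del0 delP] := symbol_unif pq a12 (divr_gt0 e0 l1).
have near_small : \forall i \near F, 2 * pi * (d i)%:R^-1 <= del by exact: (dF _ (mesh_small del0)).
apply: filterS near_small => i small j x /arc_cell_mesh jx.
rewrite -mulrBr normrM; have := delP _ _ (le_trans jx small).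
rewrite ler_pdivlMr // mulrC; apply: le_trans.
by rewrite ler_wpM2r // lerDl.
Qed.

Lemma circle_measure_bounds : (0 < @lebesgue_measure R [set` `[- pi, pi]%R] < +oo)%E.
Proof. by rewrite lebesgue_measure_circle ltry lte_fin mulr_gt0 ?pi_gt0. Qed.

(** The convergence of the coefficients is absorbed in the residual: relative to
the limit symbol it is c1 times the Toeplitz residual plus V diag(e) with
uniformly small e. *)
Lemma toeplitz_distributed1 (alpha l0 l1 : R) (d : I -> nat) (c0 c1 : I -> R)
    (A : forall i, 'M[R]_(d i)) (g : R -> R) :
  1 < alpha < 2 -> d i @[i --> F] --> \oo ->
  c0 i @[i --> F] --> l0 -> c1 i @[i --> F] --> l1 ->
  (forall i, A i = (c0 i)%:M + c1 i *: Gmx pq alpha (d i)) ->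
  (forall x, g x = l0 + l1 * symbol pq alpha x) ->
  eig_distributed1 F A g.
Proof.
move=> a12 dF c0F c1F defA defg.
have [L L0 fL] := symbol_bounded pq a12.
pose X i := A i *m hartley R (d i)
  - hartley R (d i) *m diag_mx (\row_j g (node R (d i) j)).
pose del i := `|c0 i - l0| + `|c1 i - l1| * L.
pose b i := 2 * c1 i ^+ 2 * (frob2 (residual pq alpha (d i)) / (d i)%:R)
  + 2 * del i ^+ 2.
have X_le i : (0 < d i)%N -> frob2 (X i) <= b i * (d i)%:R.
  move=> d0; pose e := \row_(j < d i) ((c0 i - l0) + (c1 i - l1) * symbol pq alpha (node R (d i) j)).
  have defX : X i = c1 i *: residual pq alpha (d i) + hartley R (d i) *m diag_mx e.
    rewrite /X defA mulmxDl mul_scalar_mx -scalemxAl; apply/matrixP => k j.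
    rewrite !mul_mx_diag /residual mul_mx_diag.
    move: (Gmx _ _ _ *m _) => Z; rewrite !mxE defg; ring.
  have edel j : `|e 0 j| <= del i.
    rewrite mxE; apply: le_trans (ler_normD _ _) _.
    by rewrite lerD2l normrM ler_wpM2l.
  apply: le_trans (frob2_perturbed (hartley_orthogonal R (d i)) defX edel) _.
  rewrite frob2Z /b [leRHS]mulrDl lerD2r -!mulrA mulVf ?mulr1 ?lexx //.
  by rewrite pnatr_eq0 -lt0n.
have b0 : b i @[i --> F] --> 0.
  have h0 : `|c0 i - l0| @[i --> F] --> 0.
    rewrite -(normr0 R) -(subrr l0); apply: cvg_norm; apply: cvgB => //; exact: cvg_cst.
  have h1 : `|c1 i - l1| @[i --> F] --> 0.
    rewrite -(normr0 R) -(subrr l1); apply: cvg_norm; apply: cvgB => //; exact: cvg_cst.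
  have hdel : del i @[i --> F] --> 0 + 0 * L.
    apply: cvgD => //; apply: cvgM => //; exact: cvg_cst.
  have hr : frob2 (residual pq alpha (d i)) / (d i)%:R @[i --> F] --> 0.
    exact: (cvg_comp _ _ dF (residual_cvg0 pq a12)).
  have -> : (0 : R) = 2 * (l1 * l1) * 0 + 2 * ((0 + 0 * L) * (0 + 0 * L)) by ring.
  rewrite /b; apply: cvgD; apply: cvgM => //.
  - by apply: cvgM; [exact: cvg_cst | exact: cvgM].
  - exact: cvg_cst.
  - exact: cvgM.
apply: (@near_eigenbasis_distributed R I F FF d A (fun i => hartley R (d i)) _ _
  (@lebesgue_measure R) `[- pi, pi] g (fun i j => node R (d i) j)
  (fun i j => @arc_cell R _ j)) => //.
- exact: circle_measure_bounds.
- apply: measurable_funTS; rewrite (_ : g = fun x => l0 + l1 * symbol pq alpha x).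
    apply: measurable_funD => //; apply: measurable_funM => //.
    exact: symbol_measurable.
  exact/funext.
- by move=> i; rewrite defA linearD linearZ /= tr_scalar_mx Gmx_sym.
- by move=> i; exact: hartley_orthogonal.
- by move=> i; exact: arc_cells.
- move=> eps e0; apply: filterS (symbol_mesh l1 a12 e0 dF) => i h j x /h.
  by rewrite !defg opprD addrACA subrr add0r.
- move=> eps e0; near=> i; apply: le_trans (X_le i _) _.
    by near: i; exact: (dF _ (nbhs_infty_gt 0)).
  rewrite ler_wpM2r //; near: i; move/cvgrPdist_le: b0 => /(_ _ e0).
  by apply: filterS => i; rewrite sub0r normrN; apply: le_trans; exact: ler_norm.
Unshelve. all: by end_near. Qed.
End Distribution.

Lemma tensmx11 (R : comPzRingType) m n :
  tensmx (1%:M : 'M[R]_m) (1%:M : 'M[R]_n) = 1%:M.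
Proof.
apply/matrixP => i j; case: (mxtens_indexP i) => i1 i2; case: (mxtens_indexP j) => j1 j2.
rewrite tensmxE !mxE (can_eq (@mxtens_indexK m n)) xpair_eqE.
by case: (i1 == j1); case: (i2 == j2); rewrite ?mulr1n ?mulr0n ?mulr1 ?mulr0 ?mul0r.
Qed.

Lemma frob2_hartley (R : realType) n : frob2 (hartley R n) <= n%:R.
Proof.
rewrite -[n%:R]mul1r -[X in frob2 X]mulmx1 -diag_const_mx.
by apply: frob2_orthogonal (hartley_orthogonal R n) _ => j; rewrite mxE expr1n.
Qed.

Section Distribution2.
Variables (R : realType) (pq : shift_pair) (I : Type) (F : set_system I).
Hypothesis FF : Filter F.

Lemma square_measure_bounds :
  (0 < (@lebesgue_measure R \x @lebesgue_measure R)
         ([set` `[- pi, pi]%R] `*` [set` `[- pi, pi]%R]) < +oo)%E.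
Proof.
have mI : measurable [set` `[- pi : R, pi]%R] by exact: measurable_itv.
have -> : ((@lebesgue_measure R \x @lebesgue_measure R)
    ([set` `[- pi, pi]%R] `*` [set` `[- pi, pi]%R]) = (2 * pi)%:E * (2 * pi)%:E)%E.
  apply: etrans (product_measure1E (@lebesgue_measure R) (@lebesgue_measure R) mI mI) _.
  by congr (_ * _)%E; exact: lebesgue_measure_circle.
by rewrite -EFinM ltry lte_fin !mulr_gt0 ?pi_gt0.
Qed.

(** The tensor product of two Hartley bases is an approximate eigenbasis.  The
residual is c1 (r1 (x) H2) + c2 (H1 (x) r2) plus a small diagonal part, and
Frobenius norms multiply under tensor products. *)
Lemma toeplitz_distributed2 (alpha1 alpha2 l0 l1 l2 : R) (d : I -> nat * nat)
    (c0 c1 c2 : I -> R) (A : forall i, 'M[R]_((d i).1 * (d i).2))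
    (g : R * R -> R) :
  1 < alpha1 < 2 -> 1 < alpha2 < 2 ->
  (d i).1 @[i --> F] --> \oo -> (d i).2 @[i --> F] --> \oo ->
  c0 i @[i --> F] --> l0 -> c1 i @[i --> F] --> l1 -> c2 i @[i --> F] --> l2 ->
  (forall i, A i = (c0 i)%:M
     + (c1 i *: tensmx (Gmx pq alpha1 (d i).1) 1%:M
        + c2 i *: tensmx 1%:M (Gmx pq alpha2 (d i).2))) ->
  (forall x, g x = l0 + (l1 * symbol pq alpha1 x.1 + l2 * symbol pq alpha2 x.2)) ->
  eig_distributed2 F A g.
Proof.
move=> a1 a2 d1F d2F c0F c1F c2F defA defg.
have [L L0 fL] := symbol_bounded pq a1.
have [L' L'0 fL'] := symbol_bounded pq a2.
pose V i : 'M[R]_((d i).1 * (d i).2) := tensmx (hartley R (d i).1) (hartley R (d i).2).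
pose p i (k : 'I_((d i).1 * (d i).2)) : R * R :=
  (node R (d i).1 (mxtens_unindex k).1, node R (d i).2 (mxtens_unindex k).2).
have orthV i : V i *m (V i)^T = 1%:M.
  by rewrite trmx_tens tensmx_mul !hartley_orthogonal tensmx11.
pose X i := A i *m V i - V i *m diag_mx (\row_k g (p i k)).
pose del i := `|c0 i - l0| + (`|c1 i - l1| * L + `|c2 i - l2| * L').
pose b i := 4 * c1 i ^+ 2 * (frob2 (residual pq alpha1 (d i).1) / (d i).1%:R)
  + 4 * c2 i ^+ 2 * (frob2 (residual pq alpha2 (d i).2) / (d i).2%:R)
  + 2 * del i ^+ 2.
have X_le i : (0 < (d i).1)%N -> (0 < (d i).2)%N ->
    frob2 (X i) <= b i * ((d i).1 * (d i).2)%:R.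
  move=> d1 d2.
  pose e := \row_(k < (d i).1 * (d i).2) ((c0 i - l0) +
    ((c1 i - l1) * symbol pq alpha1 (p i k).1 + (c2 i - l2) * symbol pq alpha2 (p i k).2)).
  pose r1 := tensmx (residual pq alpha1 (d i).1) (hartley R (d i).2).
  pose r2 := tensmx (hartley R (d i).1) (residual pq alpha2 (d i).2).
  have defX : X i = (c1 i *: r1 + c2 i *: r2) + V i *m diag_mx e.
    rewrite /X defA !mulmxDl mul_scalar_mx -!scalemxAl /V !tensmx_mul !mul1mx.
    rewrite /r1 /r2 /residual; apply/matrixP => k l.
    case: (mxtens_indexP k) => k1 k2; case: (mxtens_indexP l) => l1' l2'.
    rewrite !mul_mx_diag; move: (Gmx _ _ _ *m _) (Gmx _ _ _ *m _) => Z1 Z2.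
    have pE : p i (mxtens_index (l1', l2')) = (node R (d i).1 l1', node R (d i).2 l2').
      by rewrite /p mxtens_indexK.
    rewrite !mxE pE defg !mxtens_indexK /=; ring.
  have edel k : `|e 0 k| <= del i.
    rewrite mxE; apply: le_trans (ler_normD _ _) _; rewrite lerD2l.
    apply: le_trans (ler_normD _ _) _.
    by rewrite (normrM (c1 i - l1)) (normrM (c2 i - l2)); apply: lerD; apply: ler_wpM2l.
  apply: le_trans (frob2_perturbed (orthV i) defX edel) _.
  rewrite /b [leRHS]mulrDl lerD2r.
  have n1 : (d i).1%:R != 0 :> R by rewrite pnatr_eq0 -lt0n.
  have n2 : (d i).2%:R != 0 :> R by rewrite pnatr_eq0 -lt0n.
  have := frob2D (c1 i *: r1) (c2 i *: r2); rewrite !frob2Z.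
  have h1 : frob2 r1 <= frob2 (residual pq alpha1 (d i).1) * (d i).2%:R.
    by rewrite frob2_tens ler_wpM2l ?frob2_ge0 ?frob2_hartley.
  have h2 : frob2 r2 <= (d i).1%:R * frob2 (residual pq alpha2 (d i).2).
    by rewrite frob2_tens ler_wpM2r ?frob2_ge0 ?frob2_hartley.
  have := ler_wpM2l (sqr_ge0 (c1 i)) h1; have := ler_wpM2l (sqr_ge0 (c2 i)) h2.
  rewrite natrM.
  have -> : (4 * c1 i ^+ 2 * (frob2 (residual pq alpha1 (d i).1) / (d i).1%:R) +
    4 * c2 i ^+ 2 * (frob2 (residual pq alpha2 (d i).2) / (d i).2%:R)) *
    ((d i).1%:R * (d i).2%:R) =
    4 * (c1 i ^+ 2 * (frob2 (residual pq alpha1 (d i).1) * (d i).2%:R)) +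
    4 * (c2 i ^+ 2 * ((d i).1%:R * frob2 (residual pq alpha2 (d i).2))).
    by field; rewrite n1 n2.
  lra.
have b0 : b i @[i --> F] --> 0.
  have h (c : I -> R) (l : R) : c i @[i --> F] --> l -> `|c i - l| @[i --> F] --> 0.
    move=> cl; rewrite -(normr0 R) -(subrr l); apply: cvg_norm; apply: cvgB => //.
    exact: cvg_cst.
  have hdel : del i @[i --> F] --> 0 + (0 * L + 0 * L').
    by apply: cvgD; [exact: h | apply: cvgD; apply: cvgM; try exact: h; exact: cvg_cst].
  have hr1 : frob2 (residual pq alpha1 (d i).1) / (d i).1%:R @[i --> F] --> 0.
    exact: (cvg_comp _ _ d1F (residual_cvg0 pq a1)).
  have hr2 : frob2 (residual pq alpha2 (d i).2) / (d i).2%:R @[i --> F] --> 0.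
    exact: (cvg_comp _ _ d2F (residual_cvg0 pq a2)).
  have -> : (0 : R) = 4 * (l1 * l1) * 0 + 4 * (l2 * l2) * 0
    + 2 * ((0 + (0 * L + 0 * L')) * (0 + (0 * L + 0 * L'))) by ring.
  have cc : (4 : R) @[_ --> F] --> (4 : R) by exact: cvg_cst.
  rewrite /b; apply: cvgD; first apply: cvgD; apply: cvgM => //.
  - by apply: cvgM => //; exact: cvgM.
  - by apply: cvgM => //; exact: cvgM.
  - exact: cvg_cst.
  - exact: cvgM.
have dd : ((d i).1 * (d i).2)%N @[i --> F] --> \oo.
  move=> P [N _ NP]; suff : \forall i \near F, P ((d i).1 * (d i).2)%N by [].
  near=> i; apply: NP => /=.
  have d1 : (N <= (d i).1)%N by near: i; exact: (d1F _ (nbhs_infty_ge N)).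
  have d2 : (0 < (d i).2)%N by near: i; exact: (d2F _ (nbhs_infty_gt 0)).
  by apply: (leq_trans d1); rewrite leq_pmulr.
apply: (@near_eigenbasis_distributed R I F FF (fun i => ((d i).1 * (d i).2)%N) A V _ _
  (@lebesgue_measure R \x @lebesgue_measure R)%E (`[- pi, pi] `*` `[- pi, pi]) g p
  (fun i k => @arc_cell R _ (mxtens_unindex k).1 `*` @arc_cell R _ (mxtens_unindex k).2)) => //.
- exact: measurableX.
- exact: square_measure_bounds.
- apply: measurable_funTS.
  rewrite (_ : g = fun x => l0 + (l1 * symbol pq alpha1 x.1 + l2 * symbol pq alpha2 x.2)).
    apply: measurable_funD => //; apply: measurable_funD; apply: measurable_funM => //.
      exact: measurableT_comp (symbol_measurable pq a1) measurable_fst.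
    exact: measurableT_comp (symbol_measurable pq a2) measurable_snd.
  exact/funext.
- by move=> i; rewrite defA !linearD !linearZ /= tr_scalar_mx !trmx_tens !Gmx_sym !tr_scalar_mx.
- move=> i; rewrite muln_gt0 => /andP[d1 d2]; apply: equal_cells_prod.
  + by case/andP: (circle_measure_bounds R).
  + by case/andP: (circle_measure_bounds R).
  + exact: arc_cells.
  + exact: arc_cells.
- move=> eps e0; have e20 : 0 < eps / 2 by rewrite divr_gt0.
  apply: filterS2 (symbol_mesh pq FF l1 a1 e20 d1F) (symbol_mesh pq FF l2 a2 e20 d2F).
  move=> i h1 h2 k x [/= /h1 {}h1 /h2 {}h2].
  rewrite !defg opprD addrACA subrr add0r opprD addrACA [eps]splitr.
  apply: le_trans (ler_normD _ _) _; exact: lerD.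
- move=> eps e0; near=> i; apply: le_trans (X_le i _ _) _.
  + by near: i; exact: (d1F _ (nbhs_infty_gt 0)).
  + by near: i; exact: (d2F _ (nbhs_infty_gt 0)).
  rewrite ler_wpM2r //; near: i; move/cvgrPdist_le: b0 => /(_ _ e0).
  by apply: filterS => i; rewrite sub0r normrN; apply: le_trans; exact: ler_norm.
Unshelve. all: by end_near. Qed.
End Distribution2.

(** * Negative semidefiniteness of the Toeplitz matrices *)
Definition neg_semidef (R : realType) n (G : 'M[R]_n) : Prop :=
  forall x : 'cV[R]_n, (x^T *m G *m x) 0 0 <= 0.

Lemma quad_formE (R : comPzRingType) n (G : 'M[R]_n) (x : 'cV[R]_n) :
  (x^T *m G *m x) 0 0 = \sum_i \sum_j G i j * (x i 0 * x j 0).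
Proof.
rewrite mxE exchange_big; apply: eq_bigr => j _ /=.
rewrite mxE mulr_suml; apply: eq_bigr => i _; rewrite mxE; ring.
Qed.

Section Autocorrelation.
Variables (R : realType) (M : nat) (y : nat -> R).
Hypothesis y_supp : forall i, (M <= i)%N -> y i = 0.

Definition autocorr k := \sum_(i < M) y i * y (i + k)%N.
Local Notation r := autocorr.

Lemma sum_shift1 (h : nat -> R) : h M = 0 ->
  \sum_(i < M) h i.+1 = \sum_(i < M) h i - h 0%N.
Proof.
move=> hM; apply/eqP; rewrite -subr_eq0 opprB addrCA addrC -sumrB.
rewrite -(big_mkord predT (fun i => h i.+1 - h i)) telescope_sumr // hM.
by rewrite sub0r addNr.
Qed.

Lemma sum_shifted_sqr_le k : \sum_(i < M) y (i + k)%N ^+ 2 <= r 0.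
Proof.
elim: k => [|k IH].
  by apply: ler_sum => i _; rewrite addn0 -expr2.
under eq_bigr do rewrite addnS -addSn.
rewrite (sum_shift1 (h := fun i => y (i + k)%N ^+ 2)).
  by rewrite lerBlDr (le_trans IH) // lerDl sqr_ge0.
by rewrite y_supp ?leq_addr // expr0n.
Qed.

Lemma autocorr_le k : r k <= r 0.
Proof.
apply: (@le_trans _ _ (\sum_(i < M) (y i ^+ 2 / 2 + y (i + k)%N ^+ 2 / 2))).
  apply: ler_sum => i _; rewrite -subr_ge0.
  rewrite [leRHS](_ : _ = (y i - y (i + k)%N) ^+ 2 / 2) ?divr_ge0 ?sqr_ge0 //.
  by field.
rewrite big_split -!mulr_suml /=.
have -> : \sum_(i < M) y i ^+ 2 = r 0.
  by apply: eq_bigr => i _; rewrite addn0 expr2.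
by have := sum_shifted_sqr_le k; lra.
Qed.

(** Here 2 (r 0 - r k) is the sum over all integers of (y_(i+k) - y_i)^2, and
(u + v)^2 <= 2 u^2 + 2 v^2 splits steps of length 2 into steps of length 1.
Sums over the natural numbers leave boundary terms in y 0 and y 1, which
combine to (2 y 0 - y 1)^2 + (y 0)^2. *)
Lemma autocorr_step2 : r 0 - r 2 <= 4 * (r 0 - r 1).
Proof.
have yM k : y (M + k)%N = 0 by rewrite y_supp // leq_addr.
have s0 : \sum_(i < M) y i ^+ 2 = r 0.
  by apply: eq_bigr => i _; rewrite addn0 expr2.
have s1 : \sum_(i < M) y i.+1 ^+ 2 = r 0 - y 0%N ^+ 2.
  by rewrite (sum_shift1 (h := fun i => y i ^+ 2)) ?s0 // -(addn0 M) yM expr0n.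
have s2 : \sum_(i < M) y i.+2 ^+ 2 = r 0 - y 0%N ^+ 2 - y 1%N ^+ 2.
  by rewrite (sum_shift1 (h := fun i => y i.+1 ^+ 2)) ?s1 // -addn1 yM expr0n.
pose E := \sum_(i < M) (y i - y i.+1) ^+ 2.
have defE : E = r 0 + (r 0 - y 0%N ^+ 2) - 2 * r 1.
  rewrite -s1 -{1}s0 /r mulr_sumr -big_split -sumrB; apply: eq_bigr => i _ /=.
  by rewrite addn1; ring.
have defE' : \sum_(i < M) (y i.+1 - y i.+2) ^+ 2 = E - (y 0%N - y 1%N) ^+ 2.
  rewrite (sum_shift1 (h := fun i => (y i - y i.+1) ^+ 2)) //.
  by rewrite -[in y M](addn0 M) -addn1 !yM subrr expr0n.
(* E and its shift by one step bound the differences at distance 2. *)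
have defG : \sum_(i < M) (y i - y i.+2) ^+ 2 =
    r 0 + (r 0 - y 0%N ^+ 2 - y 1%N ^+ 2) - 2 * r 2.
  rewrite -s2 -{1}s0 /r mulr_sumr -big_split -sumrB; apply: eq_bigr => i _ /=.
  by rewrite addn2; ring.
have : \sum_(i < M) (y i - y i.+2) ^+ 2 <= 2 * E + 2 * (E - (y 0%N - y 1%N) ^+ 2).
  rewrite -defE' /E !mulr_sumr -big_split; apply: ler_sum => i _ /=.
  rewrite -subr_ge0 [leRHS](_ : _ = (y i - 2 * y i.+1 + y i.+2) ^+ 2) ?sqr_ge0 //.
  by ring.
rewrite defG defE.
have := sqr_ge0 (2 * y 0%N - y 1%N); have := sqr_ge0 (y 0%N).
rewrite !sqrrB !exprMn; lra.
Qed.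
End Autocorrelation.

(** With s the sum of the weights of index less than M + 4, half of the
quadratic form is at most
s r_0 - (omega_0 + omega_2) (r_0 - r_1) - omega_3 (r_0 - r_2): the weights from
index 4 on are nonnegative and every r_k is at most r_0.  Now s <= 0, and
r_0 - r_2 <= 4 (r_0 - r_1) together with [omega_off_diagonal] gives the sign of
the rest. *)
Lemma Gmx_neg_semidef (R : realType) pq (alpha : R) M : 1 < alpha < 2 ->
  neg_semidef (Gmx pq alpha M).
Proof.
move=> a12 x; pose w := omega pq alpha.
pose y i := if insub i is Some j then x j 0 else 0.
have yE (i : 'I_M) : y i = x i 0 by rewrite /y valK.
have y_supp i : (M <= i)%N -> y i = 0.
  by move=> Mi; rewrite /y insubN // -leqNgt.
pose r := autocorr M y.
pose Q m := \sum_(i < M) \sum_(j < M) (m + i == j.+1)%N%:R * (y i * y j).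
have QS m : Q m.+1 = r m.
  apply: eq_bigr => i _.
  transitivity (\sum_(j < M) (j + 0 == m + i)%N%:R * (y i * y j)).
    by apply: eq_bigr => j _; rewrite addn0 addSn eqSS eq_sym.
  rewrite (sum_pick M (fun j => y i * y j)) /= subn0 addnC.
  by case: ltnP => // Mim; rewrite (y_supp _ Mim) mulr0.
have Q0 : Q 0%N = r 1%N.
  rewrite /Q exchange_big; apply: eq_bigr => j _ /=.
  transitivity (\sum_(i < M) (i + 0 == j.+1)%N%:R * (y i * y j)).
    by apply: eq_bigr => i _; rewrite addn0 add0n.
  rewrite (sum_pick M (fun i => y i * y j)) /= subn0 addn1 mulrC.
  by case: ltnP => // Mj; rewrite (y_supp _ Mj) mulr0.
have -> : (x^T *m Gmx pq alpha M *m x) 0 0 = 2 * \sum_(m < M.+4) w m * Q m.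
  rewrite quad_formE mulr_sumr.
  have MM : (M < M.+4)%N by lia.
  under eq_bigr => i _ do under eq_bigr => j _ do
    rewrite (GmxE pq alpha i j MM) mulr_suml.
  under eq_bigr => i _ do rewrite exchange_big.
  rewrite exchange_big; apply: eq_bigr => m _ /=.
  transitivity (w m * (Q m + Q m)); last by ring.
  have Qsym : Q m = \sum_(i < M) \sum_(j < M) (m + j == i.+1)%N%:R * (y i * y j).
    rewrite /Q exchange_big; apply: eq_bigr => i _; apply: eq_bigr => j _.
    by rewrite [y j * _]mulrC.
  rewrite mulrDr {1}Qsym /Q !mulr_sumr -big_split; apply: eq_bigr => i _ /=.
  rewrite !mulr_sumr -big_split; apply: eq_bigr => j _ /=.
  by rewrite !yE /w; ring.
rewrite pmulr_rle0 // !big_ord_recl /= Q0 !QS /bump /= !add1n.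
have rest : \sum_(i < M) w i.+4 * Q i.+4 <= \sum_(i < M) w i.+4 * r 0%N.
  apply: ler_sum => i _; rewrite QS ler_wpM2l ?(omega_ge0 pq a12) //.
  exact: autocorr_le.
have := sum_omega_le0 pq a12 (isT : (3 < M.+4)%N).
rewrite !big_ord_recl /= /bump /= !add1n -/w.
move: rest; rewrite -mulr_suml; set S := \sum_(i < M) _.
have r1 := autocorr_le y_supp 1; have r2 := autocorr_le y_supp 2.
have r21 := autocorr_step2 y_supp.
have r0 : 0 <= r 0%N by apply: sumr_ge0 => i _; rewrite addn0 -expr2 sqr_ge0.
have [] := omega_off_diagonal pq a12; rewrite -/w -/r in r1 r2 r21 *.
move: (r 0%N) (r 1%N) (r 2%N) r0 r1 r2 r21 => r0 r1 r2 r0_ge r1_le r2_le r21.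
move: (w 0%N) (w 1%N) (w 2%N) (w 3%N) => w0 w1 w2 w3 h1 h2 rest.
rewrite -[X in w3 + X]/(\sum_(i < M) w i.+4); move: (\sum_(i < M) w i.+4) rest => s rest hsum.
have d1 : 0 <= r0 - r1 by lra.
have d2 : 0 <= r0 - r2 by lra.
have hr := mulr_le0_ge0 hsum r0_ge.
have off : 0 <= (w0 + w2) * (r0 - r1) + w3 * (r0 - r2).
  have [w3p|w3n] := leP 0 w3; first by rewrite addr_ge0 // mulr_ge0.
  have := ler_wnM2l (ltW w3n) r21; have := mulr_ge0 h2 d1; lra.
lra.
Qed.

Lemma neg_semidef_tensl (R : realType) m n (G : 'M[R]_m) :
  neg_semidef G -> neg_semidef (tensmx G (1%:M : 'M[R]_n)).
Proof.
move=> nG x; rewrite quad_formE.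
pose z (b : 'I_n) : 'cV[R]_m := \col_a x (mxtens_index (a, b)) 0.
apply: (@le_trans _ _ (\sum_b ((z b)^T *m G *m z b) 0 0)); last first.
  by apply: sumr_le0 => b _; exact: nG.
rewrite le_eqVlt; apply/orP; left; apply/eqP.
rewrite sum_mxtens exchange_big; apply: eq_bigr => b _ /=.
rewrite quad_formE; apply: eq_bigr => a _; rewrite sum_mxtens; apply: eq_bigr => a' _.
rewrite (bigD1 b) //= big1 ?addr0 => [|b' b'b]; rewrite tensmxE !mxE.
  by rewrite eqxx mulr1n mulr1.
by rewrite eq_sym (negbTE b'b) mulr0n mulr0 mul0r.
Qed.

Lemma neg_semidef_tensr (R : realType) m n (G : 'M[R]_n) :
  neg_semidef G -> neg_semidef (tensmx (1%:M : 'M[R]_m) G).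
Proof.
move=> nG x; rewrite quad_formE.
pose z (a : 'I_m) : 'cV[R]_n := \col_b x (mxtens_index (a, b)) 0.
apply: (@le_trans _ _ (\sum_a ((z a)^T *m G *m z a) 0 0)); last first.
  by apply: sumr_le0 => a _; exact: nG.
rewrite le_eqVlt; apply/orP; left; apply/eqP.
rewrite sum_mxtens; apply: eq_bigr => a _ /=.
rewrite quad_formE; apply: eq_bigr => b _; rewrite sum_mxtens exchange_big.
apply: eq_bigr => b' _ /=.
rewrite (bigD1 a) //= big1 ?addr0 => [|a' a'a]; rewrite tensmxE !mxE.
  by rewrite eqxx mulr1n mul1r.
by rewrite eq_sym (negbTE a'a) mulr0n !mul0r.
Qed.

Lemma neg_semidefZ (R : realType) n c (G : 'M[R]_n) :
  0 <= c -> neg_semidef G -> neg_semidef (c *: G).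
Proof.
move=> c0 nG x; rewrite -scalemxAr -scalemxAl mxE.
by rewrite mulr_ge0_le0 // nG.
Qed.

Lemma neg_semidefD (R : realType) n (G H : 'M[R]_n) :
  neg_semidef G -> neg_semidef H -> neg_semidef (G + H).
Proof.
by move=> nG nH x; rewrite mulmxDr mulmxDl mxE; have := nG x; have := nH x; lra.
Qed.

Lemma posdef_shift (R : realType) n c (G : 'M[R]_n) :
  0 < c -> G^T = G -> neg_semidef G -> sym_posdef (c%:M - G).
Proof.
move=> c0 symG nG; split; first by rewrite linearB /= tr_scalar_mx symG.
move=> x x0; rewrite mulmxBr mulmxBl mxE [X in _ + X]mxE subr_gt0.
apply: le_lt_trans (nG x) _; rewrite mul_mx_scalar -scalemxAl mxE mulr_gt0 //.
rewrite mxE; have [i xi] : exists i, x i 0 != 0.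
  apply/existsP; apply: contraR x0; rewrite negb_exists => /forallP x0.
  apply/eqP/matrixP => i j; rewrite mxE ord1.
  by apply/eqP; move: (x0 i); rewrite negbK.
rewrite (bigD1 i) //= mxE ltr_pwDl //.
  by rewrite -expr2 exprn_even_gt0.
by apply: sumr_ge0 => k _; rewrite mxE -expr2 sqr_ge0.
Qed.

(** * The mesh ratio gamma *)
Section Gamma.
Variable R : realType.
Implicit Types alpha h k : R.

Lemma cos_alpha_lt0 alpha : 1 < alpha < 2 -> cos (alpha * pi / 2) < 0.
Proof.
case/andP=> a1 a2; have p0 := pi_gt0 R.
have -> : alpha * pi / 2 = (alpha * pi / 2 - pi / 2) + pi / 2 by rewrite subrK.
rewrite cosDpihalf oppr_lt0 sin_gt0_pi //.
have h1 : 0 < (alpha - 1) * pi by rewrite mulr_gt0 // subr_gt0.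
have h2 : 0 < (2 - alpha) * pi by rewrite mulr_gt0 // subr_gt0.
by apply/andP; split; lra.
Qed.

Lemma cbar_gt0 alpha h : 1 < alpha < 2 -> 0 < h -> 0 < cbar alpha h.
Proof.
move=> /cos_alpha_lt0 c0 h0; rewrite /cbar oppr_gt0 invr_lt0.
by rewrite pmulr_rlt0 // mulr_gt0 // powR_gt0.
Qed.

Lemma gamE alpha k h : gam alpha k h = k * cbar alpha h.
Proof. by rewrite /gam /cbar mulrN. Qed.

Lemma gam_gt0 alpha k h : 1 < alpha < 2 -> 0 < k -> 0 < h -> 0 < gam alpha k h.
Proof. by move=> a12 k0 h0; rewrite gamE mulr_gt0 // cbar_gt0. Qed.

Lemma hx_gt0 (a b : R) M : a < b -> 0 < hx a b M.
Proof. by move=> ab; rewrite divr_gt0 ?subr_gt0. Qed.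

Lemma ht_gt0 (T : R) N : 0 < T -> (0 < N)%N -> 0 < ht T N.
Proof. by move=> T0 N0; rewrite divr_gt0 // ltr0n. Qed.

Lemma invn_cvg0 (c : R) : c / n%:R @[n --> \oo] --> 0.
Proof.
have h : (n%:R : R)^-1 @[n --> \oo] --> 0.
  apply/gtr0_cvgV0; last exact: cvgr_idn.
  by near=> n; rewrite ltr0n; near: n; exact: nbhs_infty_gt.
have := cvgM (cvg_cst c) h; rewrite mulr0; exact.
Unshelve. all: by end_near. Qed.

Lemma ht_cvg0 (T : R) (I : Type) (F : set_system I) (FF : Filter F) (N : I -> nat) :
  N i @[i --> F] --> \oo -> ht T (N i) @[i --> F] --> 0.
Proof. by move=> NF; exact: (cvg_comp _ _ NF (invn_cvg0 T)). Qed.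

Lemma hx_cvg0 (a b : R) : hx a b M @[M --> \oo] --> 0.
Proof.
have := invn_cvg0 (b - a); rewrite -(cvg_shiftS (fun n => (b - a) / n%:R)); exact.
Qed.

Lemma powR_cvg0 (I : Type) (F : set_system I) (FF : Filter F) (h : I -> R) (p : R) :
  0 < p -> (forall i, 0 < h i) -> h i @[i --> F] --> 0 ->
  h i `^ p @[i --> F] --> 0.
Proof.
move=> p0 h0 hF; apply/cvgrPdist_le => eps e0.
have del0 : 0 < eps `^ p^-1 by rewrite powR_gt0.
move/cvgrPdist_le : hF => /(_ _ del0); apply: filterS => i.
rewrite !sub0r !normrN (ger0_norm (powR_ge0 _ _)) (ger0_norm (ltW (h0 i))) => hi.
have : h i `^ p <= (eps `^ p^-1) `^ p.
  by apply: ge0_ler_powR => //; rewrite ?nnegrE ?powR_ge0 // ltW.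
by rewrite -powRrM mulVf ?gt_eqF // powRr1 ?(ltW e0).
Qed.

(** The time steps cancel, and h1^al / h2^be <= C^al h2^(al - be). *)
Lemma gam_ratio_cvg0 (I : Type) (F : set_system I) (FF : Filter F)
    (al be C : R) (h1 h2 k : I -> R) :
  1 < al < 2 -> 1 < be < 2 -> be < al -> 0 < C ->
  (forall i, 0 < h1 i) -> (forall i, 0 < h2 i) -> (forall i, 0 < k i) ->
  (\forall i \near F, h1 i <= C * h2 i) -> h2 i @[i --> F] --> 0 ->
  gam be (k i) (h2 i) / gam al (k i) (h1 i) @[i --> F] --> 0.
Proof.
move=> a12 b12 ba C0 h10 h20 k0 h12 h2F.
have ca := cos_alpha_lt0 a12; have cb := cos_alpha_lt0 b12.
set ca' := cos _ in ca; set cb' := cos _ in cb.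
pose q := ca' / cb'; have q0 : 0 < q by rewrite /q -mulrNN -invrN divr_gt0 ?oppr_gt0.
have al0 : 0 < al by case/andP: a12 => a1 _; apply: lt_trans a1.
have lim0 : q * C `^ al * h2 i `^ (al - be) @[i --> F] --> 0.
  have := cvgM (cvg_cst (q * C `^ al)) (powR_cvg0 FF (_ : 0 < al - be) h20 h2F).
  by rewrite mulr0 subr_gt0; apply.
apply: (squeeze_cvgr _ (cvg_cst 0) lim0).
near=> i; have h1i := h10 i; have h2i := h20 i; have ki := k0 i.
have p1 : 0 < h1 i `^ al by exact: powR_gt0.
have p2 : 0 < h2 i `^ be by exact: powR_gt0.
have -> : gam be (k i) (h2 i) / gam al (k i) (h1 i) = q * (h1 i `^ al / h2 i `^ be).
  rewrite /gam -/ca' -/cb' /q; field.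
  by rewrite (gt_eqF p2) (gt_eqF p1) (lt_eqF ca) (lt_eqF cb) (gt_eqF ki).
apply/andP; split; first exact: mulr_ge0 (ltW q0) (divr_ge0 (ltW p1) (ltW p2)).
rewrite -mulrA ler_wpM2l ?(ltW q0) // ler_pdivrMr // -mulrA -powRD; last first.
  by rewrite (gt_eqF h2i) implybT.
rewrite subrK -powRM ?(ltW C0) ?(ltW h2i) //; apply: ge0_ler_powR;
  rewrite ?nnegrE ?(ltW al0) ?(ltW h1i) //.
  by rewrite mulr_ge0 // ltW.
by near: i.
Unshelve. all: by end_near. Qed.

Lemma cbar_unbounded alpha (a b B : R) : 1 < alpha < 2 -> a < b ->
  \forall n \near \oo, B < cbar alpha (hx a b n).
Proof.
move=> a12 ab; have ca := cos_alpha_lt0 a12.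
have a0 : 0 < alpha by case/andP: a12 => a1 _; apply: lt_trans a1.
have h0 n : 0 < hx a b n by exact: hx_gt0.
pose f n := - (2 * hx a b n `^ alpha * cos (alpha * pi / 2)).
have f0 n : 0 < f n by rewrite /f oppr_gt0 pmulr_rlt0 // mulr_gt0 // powR_gt0.
have fc : f n @[n --> \oo] --> 0.
  have -> : f = fun n => - (2 * cos (alpha * pi / 2)) * hx a b n `^ alpha.
    by apply/funext => n; rewrite /f; ring.
  have h := cvgM (cvg_cst (- (2 * cos (alpha * pi / 2))))
    (powR_cvg0 _ a0 h0 (hx_cvg0 a b)).
  by rewrite mulr0 in h; apply: h.
have fV : (f n)^-1 @[n --> \oo] --> +oo.
  apply/gtr0_cvgV0; first by apply: nearW => n; rewrite invr_gt0.
  apply: cvg_trans fc; apply: near_eq_cvg; apply: nearW => n.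
  by rewrite /mathcomp.classical.unstable.inv_fun /= invrK.
have /cvgryPgt/(_ B) := fV; apply: filterS => n.
by rewrite /f invrN.
Unshelve. all: by end_near. Qed.
End Gamma.

(** * The discretization matrices *)
Section Schemes.
Variables (R : realType) (pq : shift_pair) (eps s T : R).
Hypotheses (s_gt0 : 0 < s) (T_gt0 : 0 < T).

Lemma Amx1E (alpha a b : R) M k :
  Amx1 pq eps s alpha a b M k =
  (1 + s * k)%:M + (- (eps ^+ 2 * gam alpha k (hx a b M))) *: Gmx pq alpha M.
Proof. by rewrite /Amx1 gamE mulrA scaleNr. Qed.

Lemma Amx1_posdef (alpha a b : R) M k : 1 < alpha < 2 -> a < b -> 0 < k ->
  sym_posdef (Amx1 pq eps s alpha a b M k).
Proof.
move=> a12 ab k0; apply: posdef_shift.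
- by rewrite addr_gt0 // mulr_gt0.
- by rewrite linearZ /= Gmx_sym.
apply: neg_semidefZ; last exact: Gmx_neg_semidef.
have c0 := cbar_gt0 a12 (hx_gt0 M ab).
exact: mulr_ge0 (mulr_ge0 (sqr_ge0 eps) (ltW k0)) (ltW c0).
Qed.

Lemma tensmxZl m n c (G : 'M[R]_m) (H : 'M[R]_n) :
  tensmx (c *: G) H = c *: tensmx G H.
Proof. by apply/matrixP => i j; rewrite !mxE mulrA. Qed.

Lemma tensmxZr m n c (G : 'M[R]_m) (H : 'M[R]_n) :
  tensmx G (c *: H) = c *: tensmx G H.
Proof. by apply/matrixP => i j; rewrite !mxE mulrCA. Qed.

Lemma Amx2E (alpha a b : R * R) m k :
  Amx2 pq eps s alpha a b m k =
  (1 + s * k)%:M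
  + ((- (eps ^+ 2 * gamj alpha a b m k Dir1)) *: tensmx (Gmx pq alpha.1 m.1) 1%:M
     + (- (eps ^+ 2 * gamj alpha a b m k Dir2)) *: tensmx 1%:M (Gmx pq alpha.2 m.2)).
Proof.
rewrite /Amx2 tensmxZl tensmxZr scalerDr !scalerA /gamj !gamE !mulrA.
by rewrite !scaleNr -opprD.
Qed.

Lemma Amx2_posdef (alpha a b : R * R) m k :
  (forall j, 1 < pcoord j alpha < 2) -> (forall j, pcoord j a < pcoord j b) ->
  0 < k -> sym_posdef (Amx2 pq eps s alpha a b m k).
Proof.
move=> a12 ab k0; have [a1 a2] := (a12 Dir1, a12 Dir2).
have c1 : 0 <= cbar alpha.1 (hxj a b m Dir1) by rewrite ltW // cbar_gt0 // hx_gt0 // (ab Dir1).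
have c2 : 0 <= cbar alpha.2 (hxj a b m Dir2) by rewrite ltW // cbar_gt0 // hx_gt0 // (ab Dir2).
apply: posdef_shift.
- by rewrite addr_gt0 // mulr_gt0.
- by rewrite linearZ linearD /= !trmx_tens !linearZ /= !Gmx_sym !tr_scalar_mx.
apply: neg_semidefZ; first by rewrite mulr_ge0 ?sqr_ge0 // ltW.
rewrite tensmxZl tensmxZr; apply: neg_semidefD; apply: neg_semidefZ => //.
  by apply: neg_semidef_tensl; exact: Gmx_neg_semidef.
by apply: neg_semidef_tensr; exact: Gmx_neg_semidef.
Qed.

Section Limits.
Variables (I : Type) (F : set_system I) (N : I -> nat).
Hypotheses (FF : Filter F) (N_gt0 : forall i, (0 < N i)%N).
Hypothesis NF : N i @[i --> F] --> \oo.
Local Notation k i := (ht T (N i)).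

Lemma mass_cvg1 : 1 + s * k i @[i --> F] --> (1 : R).
Proof.
have h := cvgD (cvg_cst (1 : R)) (cvgM (cvg_cst s) (ht_cvg0 T FF NF)).
by rewrite mulr0 addr0 in h; apply: h.
Qed.

Lemma mass_cvg0 (c : I -> R) : (forall i, 0 < c i) -> c i @[i --> F] --> +oo ->
  (c i)^-1 * (1 + s * k i) @[i --> F] --> (0 : R).
Proof.
move=> c0 cF; have cV : (c i)^-1 @[i --> F] --> 0.
  by apply/gtr0_cvgV0 => //; exact: nearW.
have h := cvgM cV mass_cvg1.
by rewrite mul0r in h; apply: h.
Qed.

Lemma scheme1_bounded (alpha a b gs : R) (M : I -> nat) :
  1 < alpha < 2 -> M i @[i --> F] --> \oo ->
  gam alpha (k i) (hx a b (M i)) @[i --> F] --> gs ->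
  eig_distributed1 F (fun i => Amx1 pq eps s alpha a b (M i) (k i))
    (fun x => 1 - eps ^+ 2 * gs * symbol pq alpha x).
Proof.
move=> a12 MF gF.
apply: (toeplitz_distributed1 FF a12 MF (l0 := 1) (l1 := - (eps ^+ 2 * gs))
  (c0 := fun i => 1 + s * k i)
  (c1 := fun i => - (eps ^+ 2 * gam alpha (k i) (hx a b (M i))))).
- exact: mass_cvg1.
- by apply: cvgN; apply: cvgM => //; exact: cvg_cst.
- by move=> i; exact: Amx1E.
- by move=> x; rewrite mulNr.
Qed.

Lemma scheme1_unbounded (alpha a b : R) (M : I -> nat) :
  1 < alpha < 2 -> a < b -> M i @[i --> F] --> \oo ->
  gam alpha (k i) (hx a b (M i)) @[i --> F] --> +oo ->
  eig_distributed1 F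
    (fun i => (gam alpha (k i) (hx a b (M i)))^-1 *: Amx1 pq eps s alpha a b (M i) (k i))
    (fun x => - (eps ^+ 2) * symbol pq alpha x).
Proof.
move=> a12 ab MF gF.
have g0 i : 0 < gam alpha (k i) (hx a b (M i)).
  by apply: gam_gt0 => //; [exact: ht_gt0 | exact: hx_gt0].
apply: (toeplitz_distributed1 FF a12 MF (l0 := 0) (l1 := - (eps ^+ 2))
  (c0 := fun i => (gam alpha (k i) (hx a b (M i)))^-1 * (1 + s * k i))
  (c1 := fun=> - (eps ^+ 2))).
- exact: mass_cvg0.
- exact: cvg_cst.
- move=> i; rewrite Amx1E scalerDr scale_scalar_mx scalerA; congr (_ + _ *: _).
  by rewrite mulrN mulrCA mulVf ?mulr1 // gt_eqF.
- by move=> x; rewrite add0r.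
Qed.

Section Plane.
Variables (alpha a b : R * R) (m : I -> nat * nat).
Hypothesis alpha12 : forall j, 1 < pcoord j alpha < 2.
Hypothesis ab : forall j, pcoord j a < pcoord j b.
Hypotheses (m1F : (m i).1 @[i --> F] --> \oo) (m2F : (m i).2 @[i --> F] --> \oo).
Local Notation gamma i j := (gamj alpha a b (m i) (k i) j).
Local Notation gammax i := (gam_max alpha a b (m i) (k i)).

Lemma gamj_gt0 i j : 0 < gamma i j.
Proof. by apply: gam_gt0; [exact: alpha12 | exact: ht_gt0 | exact: hx_gt0]. Qed.

Lemma gam_max_gt0 i : 0 < gammax i.
Proof. by rewrite lt_max gamj_gt0. Qed.

Lemma scheme2_bounded (gs1 gs2 : R) :
  gamma i Dir1 @[i --> F] --> gs1 -> gamma i Dir2 @[i --> F] --> gs2 ->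
  eig_distributed2 F (fun i => Amx2 pq eps s alpha a b (m i) (k i))
    (fun x => 1 - eps ^+ 2 * (gs1 * symbol pq alpha.1 x.1 +
                              gs2 * symbol pq alpha.2 x.2)).
Proof.
move=> g1F g2F.
apply: (toeplitz_distributed2 FF (alpha12 Dir1) (alpha12 Dir2) m1F m2F (l0 := 1)
  (l1 := - (eps ^+ 2 * gs1)) (l2 := - (eps ^+ 2 * gs2))
  (c0 := fun i => 1 + s * k i)
  (c1 := fun i => - (eps ^+ 2 * gamma i Dir1))
  (c2 := fun i => - (eps ^+ 2 * gamma i Dir2))).
- exact: mass_cvg1.
- by apply: cvgN; apply: cvgM => //; exact: cvg_cst.
- by apply: cvgN; apply: cvgM => //; exact: cvg_cst.
- by move=> i; exact: Amx2E.
- by move=> x; rewrite /=; move: (symbol _ _ _) (symbol _ _ _) => u v; ring.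
Qed.

(** After scaling, the coefficient of the dominant direction is eventually
- eps^2, that of the other direction is - eps^2 times a vanishing ratio. *)
Lemma scheme2_unbounded (j : direction) :
  (\forall i \near F, gammax i = gamma i j) ->
  gammax i @[i --> F] --> +oo ->
  gamma i (other_dir j) / gamma i j @[i --> F] --> (0 : R) ->
  eig_distributed2 F (fun i => (gammax i)^-1 *: Amx2 pq eps s alpha a b (m i) (k i))
    (fun x => - (eps ^+ 2) * symbol pq (pcoord j alpha) (pcoord j x)).
Proof.
move=> maxj gF ratio.
pose l (d : direction) : R := match j, d with
  Dir1, Dir1 | Dir2, Dir2 => - (eps ^+ 2) | _, _ => 0 end.
have cj : (gammax i)^-1 * - (eps ^+ 2 * gamma i j) @[i --> F] --> - (eps ^+ 2).
  apply: cvg_near_cst; apply: filterS maxj => i ->.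
  by rewrite mulrN mulrCA mulVf ?mulr1 // gt_eqF // gamj_gt0.
have co : (gammax i)^-1 * - (eps ^+ 2 * gamma i (other_dir j)) @[i --> F] --> 0.
  have lim0 : - eps ^+ 2 * (gamma i (other_dir j) / gamma i j) @[i --> F] --> (0 : R).
    have h := cvgM (cvg_cst (- eps ^+ 2)) ratio.
    by rewrite mulr0 in h; apply: h.
  apply: cvg_trans lim0; apply: near_eq_cvg.
  by apply: filterS maxj => i -> /=; ring.
apply: (toeplitz_distributed2 FF (alpha12 Dir1) (alpha12 Dir2) m1F m2F (l0 := 0)
  (l1 := l Dir1) (l2 := l Dir2)
  (c0 := fun i => (gammax i)^-1 * (1 + s * k i))
  (c1 := fun i => (gammax i)^-1 * - (eps ^+ 2 * gamma i Dir1))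
  (c2 := fun i => (gammax i)^-1 * - (eps ^+ 2 * gamma i Dir2))).
- by apply: mass_cvg0 => // i; exact: gam_max_gt0.
- by rewrite /l; case: (j) cj co.
- by rewrite /l; case: (j) cj co.
- by move=> i; rewrite Amx2E !scalerDr scale_scalar_mx !scalerA.
- move=> x; rewrite /l add0r; case: (j) => /=.
    by rewrite mul0r addr0.
  by rewrite mul0r add0r.
Qed.
End Plane.
End Limits.
End Schemes.

(** * Coupling of the two space directions *)
Section Grids.
Variables (R : realType) (alpha a b : R * R).
Hypothesis alpha12 : forall j, 1 < pcoord j alpha < 2.
Hypothesis ab : forall j, pcoord j a < pcoord j b.

Lemma hxj_gt0 m j : 0 < hxj a b m j.
Proof. exact: hx_gt0. Qed.

Lemma hxj_cvg0 (m : nat -> nat * nat) j :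
  (m n).1 @[n --> \oo] --> \oo -> (m n).2 @[n --> \oo] --> \oo ->
  hxj a b (m n) j @[n --> \oo] --> (0 : R).
Proof.
move=> m1 m2; case: j; rewrite /hxj /=.
  exact: (cvg_comp _ _ m1 (hx_cvg0 a.1 b.1)).
exact: (cvg_comp _ _ m2 (hx_cvg0 a.2 b.2)).
Qed.

Section Sequence.
Variables (m : nat -> nat * nat) (k : nat -> R).
Hypotheses (m1 : (m n).1 @[n --> \oo] --> \oo) (m2 : (m n).2 @[n --> \oo] --> \oo).
Hypothesis k_gt0 : forall n, 0 < k n.

Lemma comparable_ratio_cvg0 j : comparable_steps a b m ->
  pcoord (other_dir j) alpha < pcoord j alpha ->
  gamj alpha a b (m n) (k n) (other_dir j) / gamj alpha a b (m n) (k n) j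
    @[n --> \oo] --> (0 : R).
Proof.
move=> [C C0 cmp] lt_alpha.
apply: (gam_ratio_cvg0 (C := C) _ (alpha12 j) (alpha12 (other_dir j)) lt_alpha C0
  (fun n => hxj_gt0 (m n) j) (fun n => hxj_gt0 (m n) (other_dir j)) k_gt0).
  by apply: filterS cmp => n []; case: j {lt_alpha}.
exact: hxj_cvg0.
Qed.

Lemma comparable_limit_eq0 j (g g' : R) : comparable_steps a b m ->
  pcoord (other_dir j) alpha < pcoord j alpha ->
  gamj alpha a b (m n) (k n) j @[n --> \oo] --> g ->
  gamj alpha a b (m n) (k n) (other_dir j) @[n --> \oo] --> g' -> g' = 0.
Proof.
move=> cmp lt_alpha gF g'F.
set u := fun n => gamj _ _ _ _ _ j in gF; set v := fun n => gamj _ _ _ _ _ _ in g'F.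
have lim0 : v n / u n * u n @[n --> \oo] --> (0 : R).
  have h := cvgM (comparable_ratio_cvg0 cmp lt_alpha) gF.
  by rewrite mul0r in h; apply: h.
apply: (cvg_unique (@Rhausdorff R) g'F); apply: cvg_trans lim0.
apply: near_eq_cvg; apply: nearW => n /=; rewrite divfK // gt_eqF //.
by apply: gam_gt0; [exact: alpha12 | exact: k_gt0 | exact: hx_gt0].
Qed.

(** If the direction of the maximum had the smaller exponent, the ratio of its
gamma to the other one would tend to 0, though it is at least 1. *)
Lemma comparable_max_ratio_cvg0 j : comparable_steps a b m -> alpha.1 <> alpha.2 ->
  (\forall n \near \oo, gam_max alpha a b (m n) (k n) = gamj alpha a b (m n) (k n) j) ->
  gamj alpha a b (m n) (k n) (other_dir j) / gamj alpha a b (m n) (k n) j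
    @[n --> \oo] --> (0 : R).
Proof.
move=> cmp neq_alpha maxj.
have [|le_alpha] := ltP (pcoord (other_dir j) alpha) (pcoord j alpha).
  exact: comparable_ratio_cvg0.
have lt_alpha : pcoord j alpha < pcoord (other_dir j) alpha.
  rewrite lt_neqAle le_alpha andbT; apply/eqP.
  by move: neq_alpha; case: (j) => /= h ?; apply: h.
have other_otherK : other_dir (other_dir j) = j by case: (j).
have := @comparable_ratio_cvg0 (other_dir j) cmp; rewrite other_otherK => /(_ lt_alpha).
move=> /cvgrPdist_lt/(_ _ ltr01) small.
have : \forall n \near \oo, False.
  apply: filterS2 maxj small => n maxn; rewrite sub0r normrN => lt1.
  have gj d : 0 < gamj alpha a b (m n) (k n) d.
    by apply: gam_gt0; [exact: alpha12 | exact: k_gt0 | exact: hx_gt0].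
  move: lt1; rewrite gtr0_norm ?divr_gt0 // ltr_pdivrMr // mul1r ltNge -maxn.
  by rewrite /gam_max le_max; case: (j); rewrite lexx ?orbT.
by move=> /filter_ex[].
Qed.
End Sequence.

Lemma diagonal_comparable : comparable_steps a b (fun n => (n, n)).
Proof.
have l1 : 0 < b.1 - a.1 by rewrite subr_gt0 (ab Dir1).
have l2 : 0 < b.2 - a.2 by rewrite subr_gt0 (ab Dir2).
exists ((b.1 - a.1) / (b.2 - a.2) + (b.2 - a.2) / (b.1 - a.1)).
  by rewrite addr_gt0 ?divr_gt0.
apply: nearW => n; rewrite /hxj /hx /= !mulrA; split; rewrite ler_wpM2r ?invr_ge0 //.
  by rewrite mulrDl divfK ?gt_eqF // lerDl mulr_ge0 ?divr_ge0 // ltW.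
by rewrite mulrDl [X in _ <= _ + X]divfK ?gt_eqF // lerDr mulr_ge0 ?divr_ge0 // ltW.
Qed.

(** Both gammas contain the same time step, so a dominance of direction j is an
inequality between the two constants cbar.  Keeping M_j fixed while the other
dimension grows makes the other constant unbounded. *)
Lemma no_dominant_direction (k : nat * nat -> R) j : (forall m, 0 < k m) ->
  ~ (\forall m \near filter_prod \oo \oo,
       gam_max alpha a b m (k m) = gamj alpha a b m (k m) j).
Proof.
move=> k0 [[P Q] /= [[n1 _ hP] [n2 _ hQ]] PQ].
have gmax (m : nat * nat) : gam_max alpha a b m (k m) = gamj alpha a b m (k m) j ->
    cbar (pcoord (other_dir j) alpha) (hxj a b m (other_dir j)) <=
    cbar (pcoord j alpha) (hxj a b m j).
  move=> maxm; rewrite -(ler_pM2l (k0 m)) -!gamE.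
  rewrite -[leRHS]/(gamj alpha a b m (k m) j) -maxm le_max.
  by apply/orP; case: (j); [right | left]; exact: lexx.
(* The two grid dimensions are controlled separately, so the grids with one
   dimension fixed and the other arbitrarily large are among those covered. *)
case: j PQ gmax => PQ gmax.
  have [n] := filter_ex (filterI (nbhs_infty_ge n2) (cbar_unbounded
    (cbar alpha.1 (hx a.1 b.1 n1)) (alpha12 Dir2) (ab Dir2))).
  move=> [/= nn2]; apply/negP; rewrite -leNgt; apply: (gmax (n1, n)).
  by apply: PQ; split; [exact: (hP n1 (leqnn n1)) | exact: (hQ n nn2)].
have [n] := filter_ex (filterI (nbhs_infty_ge n1) (cbar_unbounded
  (cbar alpha.2 (hx a.2 b.2 n2)) (alpha12 Dir1) (ab Dir1))).
move=> [/= nn1]; apply/negP; rewrite -leNgt; apply: (gmax (n, n2)).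
by apply: PQ; split; [exact: (hP n nn1) | exact: (hQ n2 (leqnn n2))].
Qed.
End Grids.
Theorem theorem4p6 (R : realType) (pq : shift_pair) (eps s T : R)
    (eps_gt0 : 0 < eps) (s_gt0 : 0 < s) (T_gt0 : 0 < T) :
  (* one-dimensional case: (i) and (ii) *)
  (forall (alpha a b : R) (N : nat -> nat),
     1 < alpha < 2 -> a < b ->
     (forall M, (0 < N M)%N) -> N M @[M --> \oo] --> \oo ->
     let gamma M := gam alpha (ht T (N M)) (hx a b M) in
     let A M := Amx1 pq eps s alpha a b M (ht T (N M)) in
     (forall gs : R, gamma M @[M --> \oo] --> gs ->
        (forall M, sym_posdef (A M)) /\
        eig_distributed1 \oo A
          (fun x => 1 - eps ^+ 2 * gs * symbol pq alpha x)) /\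
     (gamma M @[M --> \oo] --> +oo ->
        eig_distributed1 \oo (fun M => (gamma M)^-1 *: A M)
          (fun x => - (eps ^+ 2) * symbol pq alpha x))) /\
  (* two-dimensional case: (iii) and (iv), for the two-index family in which
     M_1 and M_2 go to infinity independently *)
  (forall (alpha a b : R * R) (N : nat * nat -> nat),
     (forall j, 1 < pcoord j alpha < 2) -> (forall j, pcoord j a < pcoord j b) ->
     (forall m, (0 < N m)%N) -> N m @[m --> filter_prod \oo \oo] --> \oo ->
     let gamma m j := gamj alpha a b m (ht T (N m)) j in
     let gammax m := gam_max alpha a b m (ht T (N m)) in
     let A m := Amx2 pq eps s alpha a b m (ht T (N m)) in
     (forall gs1 gs2 : R,
        gamma m Dir1 @[m --> filter_prod \oo \oo] --> gs1 ->
        gamma m Dir2 @[m --> filter_prod \oo \oo] --> gs2 ->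
        [/\ forall m, sym_posdef (A m),
            eig_distributed2 (filter_prod \oo \oo) A
              (fun x => 1 - eps ^+ 2 * (gs1 * symbol pq alpha.1 x.1 +
                                        gs2 * symbol pq alpha.2 x.2)),
            alpha.2 < alpha.1 -> gs2 = 0
          & alpha.1 < alpha.2 -> gs1 = 0]) /\
     (forall j : direction,
        (\forall m \near filter_prod \oo \oo, gammax m = gamma m j) ->
        gammax m @[m --> filter_prod \oo \oo] --> +oo ->
        eig_distributed2 (filter_prod \oo \oo) (fun m => (gammax m)^-1 *: A m)
          (fun x => - (eps ^+ 2) * symbol pq (pcoord j alpha) (pcoord j x)))) /\
  (* two-dimensional case: (iii) and (iv), along any sequence of grids
     m_n = (M_1(n), M_2(n)) with M_1(n), M_2(n) -> oo *)
  (forall (alpha a b : R * R) (m : nat -> nat * nat) (N : nat -> nat),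
     (forall j, 1 < pcoord j alpha < 2) -> (forall j, pcoord j a < pcoord j b) ->
     (forall n, (0 < N n)%N) ->
     (m n).1 @[n --> \oo] --> \oo -> (m n).2 @[n --> \oo] --> \oo ->
     N n @[n --> \oo] --> \oo ->
     let gamma n j := gamj alpha a b (m n) (ht T (N n)) j in
     let gammax n := gam_max alpha a b (m n) (ht T (N n)) in
     let A n := Amx2 pq eps s alpha a b (m n) (ht T (N n)) in
     (forall gs1 gs2 : R,
        gamma n Dir1 @[n --> \oo] --> gs1 ->
        gamma n Dir2 @[n --> \oo] --> gs2 ->
        [/\ forall n, sym_posdef (A n),
            eig_distributed2 \oo A
              (fun x => 1 - eps ^+ 2 * (gs1 * symbol pq alpha.1 x.1 +
                                        gs2 * symbol pq alpha.2 x.2))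
          & comparable_steps a b m ->
            (alpha.2 < alpha.1 -> gs2 = 0) /\
            (alpha.1 < alpha.2 -> gs1 = 0)]) /\
     (forall j : direction,
        (\forall n \near \oo, gammax n = gamma n j) ->
        gammax n @[n --> \oo] --> +oo ->
        (comparable_steps a b m /\ alpha.1 <> alpha.2) \/
          (gamma n (other_dir j) / gamma n j @[n --> \oo] --> (0 : R)) ->
        eig_distributed2 \oo (fun n => (gammax n)^-1 *: A n)
          (fun x => - (eps ^+ 2) * symbol pq (pcoord j alpha) (pcoord j x)))).

Proof.
split; last split.
- move=> alpha a b N a12 ab N0 NF gamma A; have MF := @cvg_id nat \oo.
  split=> [gs gF|gF]; last first.
    exact: (scheme1_unbounded pq eps s T_gt0 _ N0 NF a12 ab MF gF).
  split; last exact: (scheme1_bounded pq eps s _ NF a12 MF gF).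
  by move=> M; apply: Amx1_posdef => //; exact: ht_gt0.
- move=> alpha a b N a12 ab N0 NF gamma gammax A.
  have k0 m : 0 < ht T (N m) by exact: ht_gt0.
  have m1F : m.1 @[m --> filter_prod \oo \oo] --> \oo by exact: cvg_fst.
  have m2F : m.2 @[m --> filter_prod \oo \oo] --> \oo by exact: cvg_snd.
  split=> [gs1 gs2 g1F g2F|j maxj _]; last first.
    by have := no_dominant_direction a12 ab k0 maxj.
  have nF := @cvg_id nat \oo.
  have diagF : (n, n) @[n --> \oo] --> filter_prod \oo \oo.
    exact: (@cvg_pair nat nat nat \oo \oo \oo _ _ _ id id nF nF).
  have cmp := diagonal_comparable ab.
  pose k n := ht T (N (n, n)); have kn0 n : 0 < k n by exact: k0.
  (* The limits are already attained along the grids M_1 = M_2, where the two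
     space steps are comparable. *)
  have d1 : gamj alpha a b (n, n) (k n) Dir1 @[n --> \oo] --> gs1.
    exact: (cvg_comp _ _ diagF g1F).
  have d2 : gamj alpha a b (n, n) (k n) Dir2 @[n --> \oo] --> gs2.
    exact: (cvg_comp _ _ diagF g2F).
  split.
  + by move=> m; apply: Amx2_posdef.
  + exact: (scheme2_bounded pq eps s _ NF a12 m1F m2F g1F g2F).
  + move=> lt_alpha.
    exact: (comparable_limit_eq0 a12 ab (m := fun n => (n, n)) nF nF kn0
      (j := Dir1) cmp lt_alpha d1 d2).
  + move=> lt_alpha.
    exact: (comparable_limit_eq0 a12 ab (m := fun n => (n, n)) nF nF kn0
      (j := Dir2) cmp lt_alpha d2 d1).
move=> alpha a b m N a12 ab N0 m1F m2F NF gamma gammax A.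
have k0 n : 0 < ht T (N n) by exact: ht_gt0.
split=> [gs1 gs2 g1F g2F|j maxj gF ratio].
  split.
  + by move=> n; apply: Amx2_posdef.
  + exact: (scheme2_bounded pq eps s _ NF a12 m1F m2F g1F g2F).
  + move=> cmp; split=> lt_alpha.
      exact: (comparable_limit_eq0 a12 ab m1F m2F k0 (j := Dir1) cmp lt_alpha g1F g2F).
    exact: (comparable_limit_eq0 a12 ab m1F m2F k0 (j := Dir2) cmp lt_alpha g2F g1F).
apply: (scheme2_unbounded pq eps s T_gt0 _ N0 NF a12 ab m1F m2F maxj gF).
case: ratio => // -[cmp neq_alpha].
exact: (comparable_max_ratio_cvg0 a12 ab m1F m2F k0 cmp neq_alpha maxj).
Qed.
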